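(* Let $X$ be a compact metric space with metric $d$, let $T:X\to X$ be continuous, let $\mathcal{M}(X,T)$ be the set of $T$-invariant Borel probability measures on $X$, let $g$ be a mistake function, and let $\mathcal{F}=\{f_n\}_{n\ge1}\subseteq C(X)$ be an asymptotically sub-additive potential. If $\mathcal{F}_*(\mu)=-\infty$ for all $\mu\in\mathcal{M}(X,T)$, then $P(g;T,\mathcal{F})=-\infty$. Otherwise, $$P(g;T,\mathcal{F})=\sup\{h_\mu(T)+\mathcal{F}_*(\mu):\mu\in\mathcal{M}(X,T),\ \mathcal{F}_*(\mu)\neq-\infty\}.$$
   Context: $C(X)$ is the space of continuous functions $X\to\mathbb{R}$, and $\|f\|=\max_{x\in X}|f(x)|$. $h_\mu(T)$ is the measure-theoretic (Kolmogorov–Sinai) entropy. Asymptotically sub-additive potential: a sequence $\mathcal{F}=\{f_n\}_{n\ge1}\subseteq C(X)$ such that for each $k>0$ there is a sub-additive sequence $\Phi_k=\{\varphi_n^k\}_{n\ge1}\subseteq C(X)$, i.e. $\varphi_{n+m}^k(x)\le\varphi_n^k(x)+\varphi_m^k(T^nx)$ for all $x\in X$ and $n,m\ge1$, with $\limsup_{n\to\infty}\frac1n\|f_n-\varphi_n^k\|\le\frac1k$. For $\mu\in\mathcal{M}(X,T)$ put $\mathcal{F}_*(\mu)=\lim_{n\to\infty}\frac1n\int f_n\,d\mu\in[-\infty,\infty)$ (this limit is known to exist). Mistake function: given $\epsilon_0>0$, a function $g:\mathbb{N}\times(0,\epsilon_0]\to\mathbb{N}$ such that for all $\epsilon\in(0,\epsilon_0]$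 and all $n\in\mathbb{N}$, $g(n,\epsilon)\le g(n+1,\epsilon)$ and $\lim_{n\to\infty}g(n,\epsilon)/n=0$. For $\epsilon>\epsilon_0$ set $g(n,\epsilon)=g(n,\epsilon_0)$. For a finite set $\Lambda$ of non-negative integers, $d_\Lambda(x,y)=\max\{d(T^ix,T^iy):i\in\Lambda\}$ (with $d_\emptyset=0$). Put $I(g;n,\epsilon)=\{\Lambda\subseteq\{0,1,\dots,n-1\}:\#\Lambda\ge n-g(n,\epsilon)\}$. A set $E\subseteq X$ is $(g;n,\epsilon)$-separated if for all distinct $x,y\in E$ one has $d_\Lambda(x,y)>\epsilon$ for every $\Lambda\in I(g;n,\epsilon)$. Topological pressure under the mistake function $g$: $$P(g;T,\mathcal{F},n,\epsilon)=\sup\Big\{\sum_{x\in E}e^{f_n(x)}:E\subseteq X\ (g;n,\epsilon)\text{-separated}\Big\},\qquad P(g;T,\mathcal{F})=\lim_{\epsilon\to0}\limsup_{n\to\infty}\frac1n\log P(g;T,\mathcal{F},n,\epsilon).$$ *)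

(* Defs.v *)
From HB Require Import structures.
From mathcomp Require Import all_boot all_order all_algebra.
From mathcomp Require Import all_classical all_reals all_analysis.

Set Implicit Arguments.
Unset Strict Implicit.
Unset Printing Implicit Defensive.

Import Order.TTheory GRing.Theory Num.Theory.
Import numFieldNormedType.Exports.

Local Open Scope classical_set_scope.
Local Open Scope ring_scope.

(* Every [measurableType] is pointed, so Borel measures on a metric space
   require a distinguished point: the spaces considered are nonempty. *)
#[short(type="pointedMetricType")]
HB.structure Definition PointedMetric (K : numDomainType) :=
  { M of Pointed M & Metric K M }.

Definition borel (R : realType) (X : pointedMetricType R) :=
  g_sigma_algebraType (@open X).

Section Potentials.
Context {R : realType} {X : pointedMetricType R}.
Implicit Types (T : X -> X) (f phi : nat -> X -> R).

Definition sup_norm (h : X -> R) : R := sup [set `|h x| | x in [set: X]].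

(* Sequences indexed by n >= 1 are functions on [nat] whose value at 0 is
   never constrained. *)
Definition continuous_seq f := forall n, (0 < n)%N -> continuous (f n).

Definition subadditive_potential T phi :=
  continuous_seq phi /\
  forall n m, (0 < n)%N -> (0 < m)%N ->
    forall x, phi (n + m)%N x <= phi n x + phi m (iter n T x).

Definition asymp_subadditive T f :=
  continuous_seq f /\
  forall k, (0 < k)%N -> exists phi, subadditive_potential T phi /\
    (limn_esup (fun n => (n%:R^-1 * sup_norm (f n \- phi n))%:E)
      <= (k%:R^-1)%:E)%E.

End Potentials.

Section InvariantMeasures.
Context {R : realType} {X : pointedMetricType R}.
Implicit Types (T : X -> X) (mu : probability (borel X) R).

Definition invariant_measures T : set (probability (borel X) R) :=
  [set mu | forall A : set (borel X), measurable A -> mu (T @^-1` A) = mu A].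

Definition asymptotic_integral (f : nat -> X -> R) mu : \bar R :=
  limn (fun n => (n%:R^-1)%:E * \int[mu]_x (f n x)%:E)%E.

(* Empty cells are allowed; they contribute 0 to the entropy. *)
Definition measurable_partition k (A : 'I_k -> set (borel X)) :=
  [/\ forall i, measurable (A i),
      forall i j, i != j -> A i `&` A j = set0 &
      \bigcup_i A i = [set: borel X]].

(* [ln 0 = 0] in the library, consistently with 0 log 0 = 0. *)
Definition partition_entropy mu (I : finType) (A : I -> set (borel X)) : R :=
  - \sum_(i : I) fine (mu (A i)) * ln (fine (mu (A i))).

(* The join of A, T^-1 A, ..., T^-(n-1) A, with cells indexed by itineraries. *)
Definition iterated_join T k (A : 'I_k -> set (borel X)) n
    (s : {ffun 'I_n -> 'I_k}) : set (borel X) :=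
  [set x | forall i : 'I_n, A (s i) (iter i T x)].

Definition entropy_wrt T mu k (A : 'I_k -> set (borel X)) : \bar R :=
  limn (fun n =>
    (n%:R^-1 * partition_entropy mu (@iterated_join T k A n))%:E).

Definition ks_entropy T mu : \bar R :=
  ereal_sup [set h | exists k (A : 'I_k -> set (borel X)),
    measurable_partition A /\ h = entropy_wrt T mu A].

End InvariantMeasures.

Section MistakePressure.
Context {R : realType} {X : pointedMetricType R}.
Implicit Types (T : X -> X) (f : nat -> X -> R) (g : nat -> R -> nat).

Definition mistake_function (eps0 : R) g :=
  0 < eps0 /\
  forall eps : R, 0 < eps <= eps0 ->
    (forall n, (0 < n)%N -> (g n eps <= g n.+1 eps)%N) /\
    ((g n eps)%:R / n%:R : R) @[n --> \oo] --> (0 : R).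

(* The extension g(n, eps) = g(n, eps0) for eps > eps0. *)
Definition mistake_ext (eps0 : R) g (n : nat) (eps : R) : nat :=
  if eps <= eps0 then g n eps else g n eps0.

Definition dist_on T n (L : {set 'I_n}) (x y : X) : R :=
  \big[Num.max/0]_(i in L) mdist (iter i T x) (iter i T y).

Definition mistake_sets (eps0 : R) g n (eps : R) : set {set 'I_n} :=
  [set L | (n - mistake_ext eps0 g n eps <= #|L|)%N].

Definition mistake_separated (eps0 : R) g T n (eps : R) (E : set X) :=
  forall x y, E x -> E y -> x <> y ->
    forall L, mistake_sets eps0 g eps L -> eps < @dist_on T n L x y.

Definition mistake_partition_sum (eps0 : R) g T f n (eps : R) : \bar R :=
  ereal_sup [set (\esum_(x in E) (expR (f n x))%:E)
            | E in mistake_separated eps0 g T n eps].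

Definition pressure_at (eps0 : R) g T f (eps : R) : \bar R :=
  limn_esup (fun n =>
    (n%:R^-1)%:E * lne (mistake_partition_sum eps0 g T f n eps))%E.

Definition mistake_pressure (eps0 : R) g T f : \bar R :=
  lim (pressure_at eps0 g T f eps @[eps --> 0^'+]).

End MistakePressure.

(* Main.v *)
(** For every small [eps] we bound the pressure at scale [eps] from both sides;
    this also shows that the limit [eps -> 0] exists, although [g] need not be
    monotone in [eps].

    Lower bound.  Let [mu] be invariant and [A] a partition with [k] cells.
    Choose closed [B_j] in [A_j] exhausting most of the measure, and call a time
    [i] exceptional for [x] when [T^i x] misses all the [B_j].  For an itinerary
    [s] of length [n], let [S_s] be the supremum over its cell of
    [f_n(x) - W * #(exceptional times of x)].  Gibbs' inequality bounds
    [H(A^n) + \int f_n] by [ln (\sum_s e^(S_s))] plus [W n] times the measure of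
    the exceptional set.  Pick a nearly optimal point in each cell, and greedily
    select separated ones in decreasing order of [f_n]: no modulus of continuity
    of [f_n] is needed.  Near a selected point the itinerary is prescribed
    except at mistaken and exceptional times, so giving weight [e^(-W)] to each
    of these bounds the sum over the itineraries attached to one point by
    [e^(W g(n,eps)) (1 + k e^(-W))^n].  Now let [W] be large, then [mu(U B_j)]
    close to 1.  Mistakes are harmless because [g(n,eps) = o(n)].

    Upper bound.  This is Misiurewicz's argument applied to the separated sets
    without mistakes.  The empirical measures are replaced by their limit along
    an ultrafilter, a [T]-invariant finitely additive probability [nu] on all
    subsets of [X], and the Caratheodory construction applied to
    [U |-> sup {nu K | K closed in U}] yields an invariant Borel probability
    agreeing with [nu] on Borel sets with null boundary. *)

Require Import Defs.
From HB Require Import structures.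
From mathcomp Require Import all_boot all_order all_algebra.
From mathcomp Require Import all_classical all_reals all_analysis.
From mathcomp Require Import lra zify.

Set Implicit Arguments.
Unset Strict Implicit.
Unset Printing Implicit Defensive.

Import Order.TTheory GRing.Theory Num.Theory.
Import numFieldNormedType.Exports.

Local Open Scope classical_set_scope.
Local Open Scope ring_scope.

(** * Entropy of finite distributions *)

Section FiniteEntropy.
Context {R : realType}.

Definition shannon (I : finType) (p : I -> R) : R := - \sum_i p i * ln (p i).

(** The right side is the tangent at [m] of the concave function [-x ln x]. All entropy inequalities
    below come from summing such tangents at suitable points [m]. *)
Lemma xlnx_tangent (x m : R) : 0 <= x -> 0 < m ->
  - (x * ln x) <= - (x * ln m) + (m - x).
Proof.
rewrite le_eqVlt => /predU1P[<- m0|x0 m0].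
  by rewrite !mul0r oppr0 add0r addr0 ltW.
have : x * ln (m / x) <= m - x.
  have -> : m - x = x * (m / x - 1).
    by rewrite mulrBr mulr1 mulrCA mulfV ?gt_eqF// mulr1.
  rewrite ler_pM2l//.
  have := @le_ln1Dx R (m / x - 1); rewrite addrCA subrr addr0; apply.
  by rewrite ltrBDr addNr divr_gt0.
by rewrite ln_div ?posrE// mulrBr; lra.
Qed.

(** Sum the tangents at [m = q i]: the linear terms leave [\sum q - \sum p <= 0]. Allowing [q] to be
    a sub-probability lets it be a product distribution restricted to part of its support. *)
Lemma gibbs_inequality (I : finType) (p q : I -> R) :
  (forall i, 0 <= p i) -> \sum_i p i = 1 ->
  (forall i, 0 <= q i) -> \sum_i q i <= 1 -> (forall i, 0 < p i -> 0 < q i) ->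
  shannon p <= - \sum_i p i * ln (q i).
Proof.
move=> p0 p1 q0 q1 pq; rewrite /shannon -!sumrN.
apply: (@le_trans _ _ (\sum_i (- (p i * ln (q i)) + (q i - p i)))).
  apply: ler_sum => i _; have := p0 i; rewrite le_eqVlt => /predU1P[<-|pi0].
    by rewrite !mul0r oppr0 add0r addr0.
  exact/xlnx_tangent/pq.
by rewrite big_split/= sumrB p1; lra.
Qed.

Lemma sum1_pos (I : finType) (p : I -> R) :
  (forall i, 0 <= p i) -> \sum_i p i = 1 -> exists i, 0 < p i.
Proof.
move=> p0 p1; apply/not_existsP => np; have : \sum_i p i = 0.
  apply: big1 => i _; apply/eqP; rewrite eq_le p0 andbT leNgt.
  by apply/negP/np.
by rewrite p1 => /eqP; rewrite oner_eq0.
Qed.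

(** Gibbs' inequality against [q i = e^(a i) / Z]. Summing over the support of [p] only matters
    later: [a i] is meaningful only for cells of positive measure. *)
Lemma gibbs_variational (I : finType) (p a : I -> R) :
  (forall i, 0 <= p i) -> \sum_i p i = 1 ->
  shannon p + \sum_i p i * a i <= ln (\sum_(i | 0 < p i) expR (a i)).
Proof.
move=> p0 p1; set Z := \sum_(i | _) expR _.
have Z0 : 0 < Z.
  have [i pi0] := sum1_pos p0 p1.
  rewrite /Z (bigD1 i)//= ltr_pwDl ?expR_gt0//.
  by apply: sumr_ge0 => j _; exact: expR_ge0.
pose q i := if 0 < p i then expR (a i) / Z else 0.
have qp i : 0 < p i -> 0 < q i by rewrite /q => ->; rewrite divr_gt0 ?expR_gt0.
have qs : \sum_i q i <= 1.
  by rewrite /q -big_mkcond/= -mulr_suml mulfV// gt_eqF.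
have q0 i : 0 <= q i by rewrite /q; case: ifP => // _; rewrite divr_ge0 ?expR_ge0 ?ltW.
have := gibbs_inequality p0 p1 q0 qs qp.
have -> : \sum_i p i * ln (q i) = \sum_i p i * a i - ln Z.
  rewrite -[X in _ - X]mul1r -p1 mulr_suml -sumrB; apply: eq_bigr => i _.
  have := p0 i; rewrite le_eqVlt => /predU1P[<-|pi0]; first by rewrite !mul0r subrr.
  by rewrite /q pi0 ln_div ?posrE ?expR_gt0// expRK mulrBr.
by move=> ?; lra.
Qed.

(** Gibbs' inequality against the product of the two marginals. Injectivity identifies [K] with a
    subset of [I * J], on which the product has mass at most 1. *)
Lemma shannon_joint (K I J : finType) (p : K -> R) (p1 : I -> R) (p2 : J -> R)
    (f : K -> I) (h : K -> J) :
  (forall k, 0 <= p k) -> \sum_k p k = 1 ->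
  (forall i, p1 i = \sum_(k | f k == i) p k) ->
  (forall j, p2 j = \sum_(k | h k == j) p k) ->
  injective (fun k => (f k, h k)) ->
  shannon p <= shannon p1 + shannon p2.
Proof.
move=> p0 ps p1E p2E inj.
have p1_ge0 i : 0 <= p1 i by rewrite p1E sumr_ge0.
have p2_ge0 j : 0 <= p2 j by rewrite p2E sumr_ge0.
have s1 : \sum_i p1 i = 1.
  by rewrite -ps (partition_big f xpredT)//=; apply: eq_bigr.
have s2 : \sum_j p2 j = 1.
  by rewrite -ps (partition_big h xpredT)//=; apply: eq_bigr.
have pp1 k : 0 < p k -> 0 < p1 (f k).
  move=> pk; rewrite p1E (bigD1 k)//= ltr_pwDl//.
  by apply: sumr_ge0.
have pp2 k : 0 < p k -> 0 < p2 (h k).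
  move=> pk; rewrite p2E (bigD1 k)//= ltr_pwDl//.
  by apply: sumr_ge0.
pose q k := p1 (f k) * p2 (h k).
have q_le : \sum_k q k <= 1.
  have -> : \sum_k q k = \sum_(x in [set (f k, h k) | k : K]) p1 x.1 * p2 x.2.
    by rewrite big_imset//= => k1 k2 _ _; exact: inj.
  apply: (@le_trans _ _ (\sum_x p1 x.1 * p2 x.2)).
    rewrite [leRHS](bigID (fun x => x \in [set (f k, h k) | k : K]%SET))/=.
    by rewrite lerDl sumr_ge0// => x _; rewrite mulr_ge0.
  rewrite -(pair_bigA _ (fun i j => p1 i * p2 j))/=.
  under eq_bigr do rewrite -mulr_sumr s2 mulr1.
  by rewrite s1.
apply: (le_trans (gibbs_inequality p0 ps _ q_le _)).
- by move=> k; rewrite mulr_ge0.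
- by move=> k pk; rewrite mulr_gt0 ?pp1 ?pp2.
have -> : shannon p1 = - \sum_k p k * ln (p1 (f k)).
  rewrite /shannon (partition_big f xpredT)//=; congr (- _); apply: eq_bigr => i _.
  by rewrite {1}p1E mulr_suml; apply: eq_bigr => k /eqP ->.
have -> : shannon p2 = - \sum_k p k * ln (p2 (h k)).
  rewrite /shannon (partition_big h xpredT)//=; congr (- _); apply: eq_bigr => i _.
  by rewrite {1}p2E mulr_suml; apply: eq_bigr => k /eqP ->.
rewrite -opprD -big_split/= lerN2; apply: ler_sum => k _.
have := p0 k; rewrite le_eqVlt => /predU1P[<-|pk]; first by rewrite !mul0r addr0.
by rewrite /q lnM ?posrE ?pp1 ?pp2// mulrDr.
Qed.

Lemma shannon_ge0 (I : finType) (p : I -> R) :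
  (forall i, 0 <= p i <= 1) -> 0 <= shannon p.
Proof.
move=> p01; rewrite /shannon -sumrN sumr_ge0// => i _.
have /andP[p0 p1] := p01 i.
by rewrite -mulrN mulr_ge0// oppr_ge0 ln_le0.
Qed.

(** The tangent at 1 bounds each term by 1. This is cruder than [ln #|I|], but any linear bound on
    block entropies will do. *)
Lemma shannon_le_card (I : finType) (p : I -> R) :
  (forall i, 0 <= p i) -> shannon p <= #|I|%:R.
Proof.
move=> p0; rewrite /shannon -sumrN -sum1_card natr_sum; apply: ler_sum => i _.
by have := xlnx_tangent (p0 i) (@ltr01 R); rewrite ln1; have := p0 i; lra.
Qed.

(** For each [i], take the tangent at the average of the [p t i]; averaged over [t], the linear
    corrections cancel. *)
Lemma shannon_concave (I : finType) (n : nat) (p : nat -> I -> R) :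
  (forall t i, 0 <= p t i) -> (0 < n)%N ->
  n%:R^-1 * \sum_(t < n) shannon (p t) <=
  shannon (fun i => n%:R^-1 * \sum_(t < n) p t i).
Proof.
move=> p0 n0; have n0R : 0 < n%:R :> R by rewrite ltr0n.
rewrite /shannon; under eq_bigr do rewrite -sumrN.
rewrite exchange_big/= mulr_sumr -sumrN; apply: ler_sum => i _.
set m := n%:R^-1 * \sum_(t < n) p t i.
have mE : \sum_(t < n) p t i = n%:R * m by rewrite mulrA divff ?gt_eqF// mul1r.
have : 0 <= m by rewrite mulr_ge0 ?invr_ge0 ?sumr_ge0// ltW.
(* There is no tangent at 0, but a zero average forces every [p t i] to vanish. *)
rewrite le_eqVlt => /predU1P[m0|m0].
  have pt0 (t : 'I_n) : p t i = 0.
    move/eqP : mE; rewrite -m0 mulr0 psumr_eq0; last by move=> ? _; exact: p0.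
    by move=> /allP/(_ t (mem_index_enum _))/eqP.
  by rewrite big1 ?mulr0 -?m0 ?mul0r ?oppr0// => t _; rewrite pt0 mul0r oppr0.
rewrite ler_pdivrMl//.
apply: (@le_trans _ _ (\sum_(t < n) (- (p t i * ln m) + (m - p t i)))).
  by apply: ler_sum => t _; exact: xlnx_tangent.
rewrite big_split/= sumrB sumrN -mulr_suml mE sumr_const card_ord.
by rewrite -[m *+ n]mulr_natl; lra.
Qed.

End FiniteEntropy.

(** * Sub-additive cocycles and their decomposition into blocks *)

Section SubadditiveCocycles.
Context {R : realType}.

(** [h a n] is attached to the [n] times from [a] on, such as the entropy of an itinerary block or
    [phi_n (T^a x)]. The starting time is kept because the contents on which entropies are computed
    need not be invariant. *)
Definition cocycle_subadditive (h : nat -> nat -> R) :=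
  forall a m n, h a (m + n)%N <= h a m + h (a + m)%N n.

(* Telescoping: [G c], the sum of [h a (n - a)] over the window
   [c <= a < c + q], satisfies [G c <= h c q + G c.+1]. *)
Lemma cocycle_block (h : nat -> nat -> R) (L : R) (q n : nat) :
  cocycle_subadditive h -> 0 <= L -> (forall a m, h a m <= m%:R * L) ->
  (0 < q <= n)%N ->
  q%:R * h 0%N n <= \sum_(t < n - q) h t q + 2 * q%:R ^+ 2 * L.
Proof.
move=> sub L0 hL /andP[q0 qn].
pose G c := \sum_(j < q) h (c + j)%N (n - (c + j))%N.
have step c : (c + q <= n)%N -> G c <= h c q + G c.+1.
  rewrite /G {G}; case: q q0 qn => // q' _ _ cq.
  rewrite big_ord_recl/= big_ord_recr/= addn0.
  have e : (n - c = q'.+1 + (n - (c.+1 + q')))%N.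
    by lia.
  have := sub c q'.+1 (n - (c.+1 + q'))%N; rewrite -e => H.
  rewrite (_ : \sum_(i < q') h (c + bump 0 i)%N (n - (c + bump 0 i))%N
             = \sum_(i < q') h (c.+1 + i)%N (n - (c.+1 + i))%N); last first.
    by apply: eq_bigr => i _; rewrite /bump/= add1n addSnnS.
  by rewrite -addSnnS in H; lra.
have tele m : (m + q <= n)%N -> G 0%N <= \sum_(t < m) h t q + G m.
  elim: m => [|m ih] mq; first by rewrite big_ord0 add0r.
  rewrite big_ord_recr/=; have := step m (ltnW mq); have := ih (ltnW mq).
  lra.
(* The last window consists of [q] blocks of length at most [q]. *)
have Gq : G (n - q)%N <= q%:R ^+ 2 * L.
  rewrite /G; apply: (@le_trans _ _ (\sum_(j < q) q%:R * L)).
    apply: ler_sum => j _; apply: (le_trans (hL _ _)).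
    rewrite ler_wpM2r// ler_nat subnDA subKn//; exact: leq_subr.
  by rewrite sumr_const card_ord -[_ *+ q]mulr_natl mulrA expr2.
(* Cutting off the first [j < q] times costs at most [q L]; sum over the [q] phases [j]. *)
have first : q%:R * h 0%N n <= q%:R ^+ 2 * L + G 0%N.
  have -> : q%:R * h 0%N n = \sum_(j < q) h 0%N n.
    by rewrite sumr_const card_ord mulr_natl.
  apply: (@le_trans _ _ (\sum_(j < q) (q%:R * L + h j (n - j)%N))).
    apply: ler_sum => j _; have jn : (j <= n)%N.
      by rewrite (leq_trans _ qn)// ltnW.
    have := sub 0%N j (n - j)%N; rewrite subnKC// => /le_trans; apply.
    rewrite add0n lerD2r; apply: (le_trans (hL _ _)).
    by rewrite ler_wpM2r// ler_nat ltnW.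
  have -> : G 0%N = \sum_(j < q) h j (n - j)%N by apply: eq_bigr.
  by rewrite big_split/= sumr_const card_ord -[_ *+ q]mulr_natl; lra.
have := tele (n - q)%N; rewrite subnK// leqnn => /(_ isT); lra.
Qed.

End SubadditiveCocycles.

(** Take a maximiser of [F], discard all that is close to it, and recurse: whatever is discarded is
    dominated by the element that eliminated it. *)
Lemma greedy_independent (R : realType) (I : finType) (close : rel I)
    (F : I -> R) (S : {set I}) :
  reflexive close -> symmetric close ->
  exists E : {set I}, [/\ E \subset S,
    {in E &, forall s t, s != t -> ~~ close s t} &
    {in S, forall s, exists2 t, t \in E & close s t /\ F s <= F t}].
Proof.
move=> refl sym; have [n] := ubnP #|S|; elim: n S => // n ih S Sn.
have [->|[s0 s0S]] := set_0Vmem S.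
  by exists finset.set0; split=> [|s|s]; rewrite ?inE// finset.sub0set.
pose t := [arg max_(t > s0 in S) F t]%O.
have [tS tmax] : t \in S /\ {in S, forall s, F s <= F t}.
  by rewrite /t; case: arg_maxP.
pose S' := [set s in S | ~~ close s t]%SET.
have S'S : S' \subset S by apply/fintype.subsetP => s; rewrite inE => /andP[].
have /ih[E [ES' Eind Ecov]] : (#|S'| < n)%N.
  apply: (@leq_trans #|S|); last by rewrite -ltnS.
  apply: proper_card; rewrite properE S'S/=.
  by apply/fintype.subsetPn; exists t => //; rewrite inE refl andbF.
exists (t |: E)%SET; split.
- by rewrite finset.subUset finset.sub1set tS/= (fintype.subset_trans ES').
- have Et s : s \in E -> ~~ close s t.
    by move=> /(fintype.subsetP ES'); rewrite inE => /andP[].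
  move=> s s'; rewrite !inE => /predU1P[->|sE] /predU1P[->|s'E]//.
  + by rewrite eqxx.
  + by move=> _; rewrite sym Et.
  + by move=> _; rewrite Et.
  + exact: Eind.
- move=> s sS; have [st|nst] := boolP (close s t).
    by exists t; [rewrite !inE eqxx|split=> //; exact: tmax].
  have /Ecov[u uE cu] : s \in S' by rewrite inE sS.
  by exists u => //; rewrite !inE uE orbT.
Qed.

(** * Limits in the extended reals *)

Section ExtendedLimits.
Context {R : realType}.
Local Open Scope ereal_scope.

Lemma cvge_gt_near {I : Type} {F : set_system I} {FF : Filter F}
    (f : I -> \bar R) (l c : \bar R) :
  f @ F --> l -> c < l -> \forall i \near F, c < f i.
Proof.
by move=> fl cl; apply: (fl [set y | c < y]); exact: open_ereal_gt'.
Qed.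

Lemma cvge_lt_near {I : Type} {F : set_system I} {FF : Filter F}
    (f : I -> \bar R) (l c : \bar R) :
  f @ F --> l -> l < c -> \forall i \near F, f i < c.
Proof.
by move=> fl cl; apply: (fl [set y | y < c]); exact: open_ereal_lt'.
Qed.

(** Real thresholds treat finite and infinite limits alike, so later bounds are stated for a real
    [c] only. *)
Lemma cvge_squeeze_real {I : Type} {F : set_system I} {FF : Filter F}
    (f : I -> \bar R) (l : \bar R) :
  (forall c : R, c%:E < l -> \forall i \near F, c%:E <= f i) ->
  (forall c : R, l < c%:E -> \forall i \near F, f i <= c%:E) ->
  f @ F --> l.
Proof.
move: l => [l| |] lo up.
- apply/fine_cvgP; split.
    near=> i; rewrite fin_numE; apply/andP; split.
    + rewrite gt_eqF// (@lt_le_trans _ _ (l - 1)%:E) ?ltNyr//; near: i.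
      by apply: lo; rewrite lte_fin; lra.
    + rewrite lt_eqF// (@le_lt_trans _ _ (l + 1)%:E) ?ltry//; near: i.
      by apply: up; rewrite lte_fin; lra.
  apply/cvgrPdist_le => e e0; near=> i.
  have h1 : (l - e)%:E <= f i by near: i; apply: lo; rewrite lte_fin; lra.
  have h2 : f i <= (l + e)%:E by near: i; apply: up; rewrite lte_fin; lra.
  rewrite /=; case: (f i) h1 h2 => [r| |]//=; rewrite !lee_fin => h1 h2.
  by rewrite ler_norml; lra.
- by apply/cvgeyPge => A; apply: lo; rewrite ltry.
- by apply/cvgeNyPle => A; apply: up; rewrite ltNyr.
Unshelve. all: by end_near. Qed.

Lemma limn_esup_ge_near (u : nat -> \bar R) c :
  (\forall n \near \oo, c <= u n) -> c <= limn_esup u.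
Proof.
move=> cu; apply: le_ereal_inf_tmp => _ [V FV <-].
have [n [Vn cn]] := filter_ex (filterI FV cu).
by apply: (le_trans cn); apply: ereal_sup_ubound; exists n.
Qed.

Lemma limn_esup_gt_freq (u : nat -> \bar R) c : c < limn_esup u ->
  forall N, exists2 n, (N <= n)%N & c < u n.
Proof.
move=> cu N; have : c < ereal_sup (u @` [set n | (N <= n)%N]).
  apply: (lt_le_trans cu); apply: ereal_inf_lbound.
  by exists [set n | (N <= n)%N] => //; exists N.
by move=> /ereal_sup_gt[_ [n Nn <-] ?]; exists n.
Qed.

Lemma limn_esup_lt_near (u : nat -> \bar R) c : limn_esup u < c ->
  \forall n \near \oo, u n < c.
Proof.
move=> /ereal_inf_lt[_ [V FV <-] Vc]; apply: filterS FV => n Vn.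
by apply: le_lt_trans Vc; apply: ereal_sup_ubound; exists n.
Qed.

(** The limit is the limsup of [u]. Given [c < c'] below it, an approximant within [(c' - c) / 4] is
    often above [c' - (c' - c) / 4]; as it converges, it eventually stays above a level that keeps
    [u] above [c]. *)
Lemma cvg_approx (u : nat -> R) :
  (forall e : R, (0 < e)%R -> exists2 v : nat -> R,
     cvgn (fun n => (v n)%:E) &
     \forall n \near \oo, (`|u n - v n| <= e)%R) ->
  cvgn (fun n => (u n)%:E).
Proof.
move=> uv; apply/cvg_ex; exists (limn_esup (fun n => (u n)%:E)).
apply: cvge_squeeze_real => [c cl|c lc]; last first.
  by near=> n; apply: ltW; near: n; exact: limn_esup_lt_near.
have [c' cc' c'l] : exists2 c' : R, (c < c')%R & c'%:E < limn_esup (fun n => (u n)%:E).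
  move: cl; case: limn_esup => [l| |//] cl.
  - by rewrite lte_fin in cl; exists ((c + l) / 2)%R; rewrite ?lte_fin; lra.
  - by exists (c + 1)%R; [lra|rewrite ltry].
have e0 : (0 < (c' - c) / 4)%R by lra.
have [v /cvg_ex[l vl] close] := uv _ e0.
have lc : (c' - 2 * ((c' - c) / 4))%:E < l.
  rewrite ltNge; apply/negP => lle.
  have near_lt : \forall n \near \oo, (v n < c' - (c' - c) / 4)%R.
    have := cvge_lt_near (c := (c' - (c' - c) / 4)%:E) vl.
    by apply; apply: (le_lt_trans lle); rewrite lte_fin; lra.
  have [N _ NP] := filterI close near_lt.
  have [n Nn] := limn_esup_gt_freq c'l N; rewrite lte_fin => c'u.
  by have [/= + vn] := NP n Nn; rewrite ler_norml => /andP[]; lra.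
near=> n; rewrite lee_fin.
have : (c' - 2 * ((c' - c) / 4) < v n)%R.
  by rewrite -lte_fin; near: n; exact: cvge_gt_near lc.
have : (`|u n - v n| <= (c' - c) / 4)%R by near: n.
by rewrite ler_norml => /andP[]; lra.
Unshelve. all: by end_near. Qed.

Lemma near_inv_le (C e : R) : (0 < e)%R ->
  \forall n \near \oo, (n%:R^-1 * C <= e)%R.
Proof.
move=> e0; have : ((n%:R^-1 * C)%R @[n --> \oo] --> (0 * C)%R).
  apply: cvgM; last exact: cvg_cst.
  rewrite -cvg_shiftS/=; exact: cvg_harmonic.
by rewrite mul0r => /cvgr_le; apply.
Qed.

(** [cocycle_block] with [h] independent of the starting time compares [a n / n] with [a q / q] up
    to an error [O(1/n)]. Without a lower bound on [a] the limit may be [-oo], hence the extended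
    reals. *)
Lemma fekete (a : nat -> R) (L : R) : (0 <= L)%R ->
  (forall m n, a (m + n)%N <= a m + a n)%R ->
  (forall n, a n <= n%:R * L)%R ->
  cvgn (fun n => (n%:R^-1 * a n)%:E).
Proof.
move=> L0 sub aL; pose u n := (n%:R^-1 * a n)%:E.
apply/cvg_ex; exists (ereal_inf (u @` [set n | (0 < n)%N])).
apply: cvge_squeeze_real => [c cl|c].
  exists 1%N => // n /= n0; apply/ltW/(lt_le_trans cl)/ereal_inf_lbound.
  by exists n.
move=> /ereal_inf_lt[_ [q q0 <-]]; rewrite /u lte_fin => qc.
have q0R : (0 < q%:R :> R)%R by rewrite ltr0n.
have e0 : (0 < c - q%:R^-1 * a q)%R by lra.
near=> n; rewrite lee_fin.
have qn : (q <= n)%N by near: n; exact: nbhs_infty_ge.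
have n0 : (0 < n%:R :> R)%R by rewrite ltr0n (leq_trans _ qn).
have := @cocycle_block R (fun _ m => a m) L q n (fun _ => sub) L0 (fun _ => aL).
rewrite q0 qn => /(_ isT) /=.
rewrite sumr_const card_ord -[(a q *+ _)%R]mulr_natl natrB// => H.
have key : (n%:R^-1 * a n <= q%:R^-1 * a q + n%:R^-1 * (2 * q%:R * L - a q))%R.
  rewrite ler_pdivrMl// -(ler_pM2l q0R); apply: (le_trans H).
  have -> : (q%:R * (n%:R * (q%:R^-1 * a q + n%:R^-1 * (2 * q%:R * L - a q))) =
      (q%:R / q%:R) * n%:R * a q + (n%:R / n%:R) * q%:R * (2 * q%:R * L - a q))%R.
    by lra.
  by rewrite !divff ?gt_eqF//; lra.
apply: (le_trans key).
have : (n%:R^-1 * (2 * q%:R * L - a q) <= c - q%:R^-1 * a q)%R.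
  by near: n; exact: near_inv_le.
lra.
Unshelve. all: by end_near. Qed.

End ExtendedLimits.

(** * Finitely additive probabilities *)

Section FinitelyAdditive.
Context {R : realType} {T : Type}.
Implicit Types (D : set (set T)) (Q : set T -> R).

Definition set_algebra D :=
  [/\ D setT, forall A, D A -> D (~` A) & forall A B, D A -> D B -> D (A `|` B)].

(* [D] is the class of sets on which [Q] is constrained: all subsets for the
   empirical contents and their limits, the Borel sets for measures. *)
Definition finprob D Q :=
  [/\ forall A, D A -> 0 <= Q A, Q setT = 1 &
      forall A B, D A -> D B -> A `&` B = set0 -> Q (A `|` B) = Q A + Q B].

Lemma set_algebraT : set_algebra [set: set T].
Proof. by []. Qed.

Lemma finprobW D Q : finprob [set: set T] Q -> finprob D Q.
Proof. by case=> Q0 Q1 QU; split=> // [A _|A B _ _]; [exact: Q0|exact: QU]. Qed.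

Section Algebra.
Variables (D : set (set T)) (Q : set T -> R).
Hypotheses (algD : set_algebra D) (pQ : finprob D Q).

Lemma set_algebra0 : D set0.
Proof. by have [DT DC _] := algD; rewrite -setCT; exact: DC. Qed.

Lemma set_algebraI A B : D A -> D B -> D (A `&` B).
Proof.
move=> DA DB; have [_ DC DU] := algD.
by rewrite -[A]setCK -[B]setCK -setCU; apply: (DC); apply: DU; exact: (DC).
Qed.

Lemma set_algebraD A B : D A -> D B -> D (A `\` B).
Proof.
move=> DA DB; have [_ DC _] := algD.
by rewrite setDE; apply: set_algebraI => //; exact: DC.
Qed.

Lemma set_algebra_bigU (I : Type) (s : seq I) (F : I -> set T) :
  (forall i, D (F i)) -> D (\big[setU/set0]_(i <- s) F i).
Proof.
move=> DF; elim: s => [|i s ih]; first by rewrite big_nil; exact: set_algebra0.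
by rewrite big_cons; have [_ _ DU] := algD; exact: DU.
Qed.

Lemma finprob0 : Q set0 = 0.
Proof.
have [_ _ QU] := pQ; have := QU _ _ set_algebra0 set_algebra0 (setI0 _).
by rewrite setU0 => /eqP; rewrite addrC -subr_eq subrr eq_sym => /eqP.
Qed.

Lemma finprob_le A B : D A -> D B -> A `<=` B -> Q A <= Q B.
Proof.
move=> DA DB AB; have [Q0 _ QU] := pQ; have DBA := set_algebraD DB DA.
rewrite -(setDUK AB) QU ?setDIK// ?lerDl ?Q0//.
Qed.

Lemma finprob_ge0 A : D A -> 0 <= Q A.
Proof. by case: pQ => Q0 _ _; exact: Q0. Qed.

Lemma finprob_le1 A : D A -> Q A <= 1.
Proof.
by move=> DA; case: (pQ) => _ <- _; apply: finprob_le => //; case: algD.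
Qed.

Lemma finprob_bigU_le (I : Type) (s : seq I) (F : I -> set T) :
  (forall i, D (F i)) ->
  Q (\big[setU/set0]_(i <- s) F i) <= \sum_(i <- s) Q (F i).
Proof.
move=> DF; elim: s => [|i s ih]; first by rewrite !big_nil finprob0.
rewrite !big_cons; set B := \big[_/_]_(_ <- _) _ in ih *.
have DB : D B by exact: set_algebra_bigU.
have -> : F i `|` B = F i `|` (B `\` F i).
  by apply/seteqP; split=> x; [case: (pselect (F i x)); [left|move=> ? [//|?]; right]|
    case=> [|[]]; [left|right]].
have [_ _ QU] := pQ.
rewrite QU ?setDIK//; last exact: set_algebraD.
by rewrite lerD2l (le_trans _ ih)// finprob_le//; exact: set_algebraD.
Qed.

Lemma finprob_bigU (I : eqType) (s : seq I) (F : I -> set T) :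
  uniq s -> (forall i, D (F i)) -> (forall i j, i != j -> F i `&` F j = set0) ->
  Q (\big[setU/set0]_(i <- s) F i) = \sum_(i <- s) Q (F i).
Proof.
move=> + DF dF; elim: s => [|i s ih] /=; first by rewrite !big_nil finprob0.
move=> /andP[si us]; have [_ _ QU] := pQ.
rewrite !big_cons QU ?ih//; first exact: set_algebra_bigU.
rewrite big_distrr/= big_seq big1// => j js; apply: dF.
by apply: contraNneq si => ->.
Qed.

Lemma finprob_total (I : finType) (F : I -> set T) A :
  D A -> (forall i, D (F i)) -> (forall i j, i != j -> F i `&` F j = set0) ->
  A `<=` \bigcup_i F i -> Q A = \sum_i Q (A `&` F i).
Proof.
move=> DA DF dF AF; rewrite -(@finprob_bigU _ (index_enum I) (fun i => A `&` F i)).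
- congr Q; apply/seteqP; split=> x.
    move=> Ax; have [i _ Fix] := AF _ Ax.
    by rewrite -bigcup_seq; exists i; [exact: mem_index_enum|split].
  by rewrite -bigcup_seq => -[i _ []].
- exact: index_enum_uniq.
- by move=> i; exact: set_algebraI.
- by move=> i j ij; rewrite setIACA dF// setI0.
Qed.

End Algebra.
End FinitelyAdditive.

Lemma set_algebra_measurable d (T : measurableType d) :
  set_algebra (@measurable d T).
Proof. by split=> // [A|A B]; [exact: measurableC|exact: measurableU]. Qed.

Lemma finprob_probability d (T : measurableType d) (R : realType)
  (mu : probability T R) : finprob measurable (fun A => fine (mu A)).
Proof.
split=> [A mA||A B mA mB AB]; first by rewrite fine_ge0.
- by rewrite probability_setT.
- by rewrite measureU// fineD// fin_num_measure.
Qed.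

(** * From finitely additive probabilities to Borel measures *)

Section ContentToMeasure.
Context {R : realType} {X : pointedMetricType R}.
Hypothesis hX : compact [set: X].
Variable nu : set X -> R.
Hypothesis pnu : finprob [set: set X] nu.
Local Open Scope ereal_scope.

(** Closed sets are compact here; this is what upgrades the finite additivity of [nu] to countable
    sub-additivity on open sets. *)
Definition inner_content (U : set X) : \bar R :=
  ereal_sup [set (nu K)%:E | K in [set K | closed K /\ K `<=` U]].

Definition outer_content (A : set X) : \bar R :=
  ereal_inf [set inner_content U | U in [set U | open U /\ A `<=` U]].

Let algT := @set_algebraT X.
Local Notation nu_le := (@finprob_le R X setT nu algT pnu).

Lemma le_inner_content U V : U `<=` V -> inner_content U <= inner_content V.
Proof.
move=> UV; apply: ereal_sup_le => _ [K [cK KU] <-].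
by exists K => //; split=> //; exact: subset_trans UV.
Qed.

Lemma inner_content_ge0 U : 0 <= inner_content U.
Proof.
apply: ereal_sup_ubound; exists set0; last by rewrite (finprob0 algT pnu).
by split; [exact: closed0|].
Qed.

Lemma inner_content_ge U K : closed K -> K `<=` U -> (nu K)%:E <= inner_content U.
Proof. by move=> cK KU; apply: ereal_sup_ubound; exists K. Qed.

Lemma inner_content_le U : inner_content U <= (nu U)%:E.
Proof.
by apply: ge_ereal_sup => _ [K [_ KU] <-]; rewrite lee_fin; apply: nu_le.
Qed.

Lemma outer_content_open U : open U -> outer_content U = inner_content U.
Proof.
move=> oU; apply/eqP; rewrite eq_le; apply/andP; split.
  by apply: ereal_inf_lbound; exists U => //; split.
by apply: le_ereal_inf_tmp => _ [V [_ UV] <-]; exact: le_inner_content.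
Qed.

Lemma outer_content_closed K : closed K -> (nu K)%:E <= outer_content K.
Proof.
by move=> cK; apply: le_ereal_inf_tmp => _ [V [_ UV] <-]; exact: inner_content_ge.
Qed.

(** The points whose [r]-ball leaves [U] form the open [r]-neighbourhood of the complement of
    [U]. *)
Lemma closed_ball_subset (K U : set X) (r : R) : closed K ->
  closed [set x | K x /\ ball x r `<=` U].
Proof.
move=> cK; have -> : [set x | K x /\ ball x r `<=` U] =
    K `&` ~` [set x | exists2 y, ball x r y & ~ U y].
  apply/seteqP; split=> x [Kx h]; split=> //; first by move=> [y /h].
  by move=> y xy; apply: contrapT => Uy; apply: h; exists y.
apply: closedI => //; apply: open_closedC; rewrite openE => x [y xy Uy].
have e0 : (0 < r - mdist x y)%R.
  by move: xy; rewrite ballEmdist/= => xy; rewrite subr_gt0.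
apply/nbhs_ballP; exists (r - mdist x y)%R => // z; rewrite !ballEmdist/= => xz.
exists y => //; rewrite ballEmdist/=.
have := metric_triangle z x y; rewrite (metric_sym z x); lra.
Qed.

(* A closed [K] covered by the [U n] is a finite union of the closed sets of
   points of [K] whose ball of a fixed radius lies in [U i]. *)
Lemma inner_content_bigcup (U : (set X)^nat) : (forall n, open (U n)) ->
  inner_content (\bigcup_n U n) <= \sum_(n <oo) inner_content (U n).
Proof.
move=> oU; apply: ge_ereal_sup => _ [K [cK KU] <-].
have cptK : compact K by exact: subclosed_compact hX _.
pose C N i := [set x | K x /\ ball x (N.+1%:R^-1) `<=` U i].
(* A Lebesgue number of the cover: by compactness a single [N] serves both as a bound on the indices
   and as the inverse of a radius. *)
have [N KN] : exists N, K `<=` \big[setU/set0]_(i < N) C N i.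
  have /compact_near_coveringP/(_ nat \oo
    (fun N x => exists2 i, (i < N)%N & ball x (N.+1%:R^-1) `<=` U i)) := cptK.
  move=> /(_ _)[x Kx|N _ NP].
    have [i _ Uix] := KU _ Kx.
    have [e e0 eU] : exists2 e : R, (0 < e)%R & ball x e `<=` U i.
      by have /nbhs_ballP[e e0 ?] := open_nbhs_nbhs (conj (oU i) Uix); exists e.
    have e2 : (0 < e / 2)%R by rewrite divr_gt0.
    exists (ball x (e / 2), [set N | (i < N)%N /\ (N.+1%:R^-1 < e / 2)%R]).
      split=> /=; first by exact: nbhsx_ballx.
      near=> N; split; first by near: N; exact: nbhs_infty_gt.
      by near: N; exact: (near_infty_natSinv_lt (PosNum e2)).
    move=> [y N] /= [xy [iN Ne]]; exists i => // z yz; apply: eU.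
    have := ball_triangle xy (le_ball (ltW Ne) yz).
    by rewrite -splitr.
  exists N => x Kx; have [i iN xU] := NP N (leqnn N) x Kx.
  by rewrite -(bigcup_mkord N (C N)); exists i.
apply: (@le_trans _ _ (\sum_(i < N) inner_content (U i))); last first.
  rewrite -(big_mkord xpredT (fun i => inner_content (U i))).
  by apply: nneseries_lim_ge => n _ _; exact: inner_content_ge0.
apply: (@le_trans _ _ (\sum_(i < N) (nu (C N i))%:E)).
  rewrite sumEFin lee_fin; apply: le_trans (finprob_bigU_le algT pnu _ _) => //.
  exact: nu_le.
apply: lee_sum => i _; apply: inner_content_ge; first exact: closed_ball_subset.
by move=> x [_]; apply; apply: ballxx; rewrite invr_gt0.
Unshelve. all: by end_near. Qed.

Let outer_content0 : outer_content set0 = 0.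
Proof.
apply/eqP; rewrite outer_content_open; last exact: open0.
rewrite eq_le inner_content_ge0 andbT (le_trans (inner_content_le _))//.
by rewrite (finprob0 algT pnu).
Qed.

Let outer_content_ge0 A : 0 <= outer_content A.
Proof. by apply: le_ereal_inf_tmp => _ [U _ <-]; exact: inner_content_ge0. Qed.

Let le_outer_content : {homo outer_content : A B / A `<=` B >-> A <= B}.
Proof.
move=> A B AB; apply: ereal_inf_le_tmp => _ [U [oU BU] <-].
by exists U => //; split=> //; exact: subset_trans BU.
Qed.

(** Open supersets chosen with errors [e / 2^(n+1)] reduce the claim to [inner_content_bigcup]. *)
Let outer_content_sigma_subadditive : sigma_subadditive outer_content.
Proof.
move=> F; apply/lee_addgt0Pr => e e0.
have outer_fin A : outer_content A \is a fin_num.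
  rewrite ge0_fin_numE// (@le_lt_trans _ _ 1)// ?ltry//.
  rewrite (le_trans (le_outer_content (@subsetT _ A)))//.
  rewrite outer_content_open; last exact: openT.
  by rewrite (le_trans (inner_content_le _))//; case: pnu => _ ->.
have /choice[U UP] n : exists U, [/\ open U, F n `<=` U &
    inner_content U <= outer_content (F n) + (e / (2 ^ n.+1)%:R)%:E].
  have : outer_content (F n) < outer_content (F n) + (e / (2 ^ n.+1)%:R)%:E.
    by rewrite lteDl// lte_fin divr_gt0// ltr0n expn_gt0.
  move=> /ereal_inf_lt[_ [U [oU FU] <-] /ltW UF].
  by exists U.
apply: le_trans (epsilon_trick _ _ (ltW e0)); last by move=> n; exact: outer_content_ge0.
apply: (@le_trans _ _ (\sum_(n <oo) inner_content (U n))); last first.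
  by apply: lee_nneseries => n *; [exact: inner_content_ge0|case: (UP n)].
apply: (@le_trans _ _ (inner_content (\bigcup_n U n))); last first.
  by apply: inner_content_bigcup => n; case: (UP n).
apply: ereal_inf_lbound; exists (\bigcup_n U n) => //; split.
  by apply: bigcup_open => n _; case: (UP n).
by apply: subset_bigcup => n _; case: (UP n).
Qed.

HB.instance Definition _ := isOuterMeasure.Build R X outer_content
  outer_content0 outer_content_ge0 le_outer_content
  outer_content_sigma_subadditive.

(* If [K] is closed in [V `&` U] and [L] is closed in [V `\` K], then [K] and
   [L] are disjoint and closed in [V], so additivity of [nu] applies. *)
Let outer_content_caratheodory U : open U ->
  caratheodory_measurable outer_content U.
Proof.
move=> oU; apply: le_caratheodory_measurable => A.
apply: le_ereal_inf_tmp => _ [V [oV AV] <-].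
apply: (@le_trans _ _ (outer_content (V `&` U) + outer_content (V `&` ~` U))).
  by apply: leeD; apply: le_outer_content; apply: setSI.
rewrite outer_content_open; last exact: openI.
apply/lee_addgt0Pr => e e0.
have [K [cK KVU nuK]] : exists K, [/\ closed K, K `<=` V `&` U &
    inner_content (V `&` U) <= (nu K + e)%:E].
  have : inner_content (V `&` U) - e%:E < inner_content (V `&` U).
    rewrite lteBlDr// lteDl ?lte_fin//.
    rewrite ge0_fin_numE ?inner_content_ge0// (le_lt_trans (inner_content_le _))// ltry//.
  move=> /ereal_sup_gt[_ [K [cK KVU] <-]] h; exists K; split=> //.
  by rewrite EFinD -leeBlDr// ltW.
apply: (@le_trans _ _ ((nu K + e)%:E + outer_content (V `&` ~` U))).
  exact: leeD2r.
rewrite EFinD addeAC; apply: leeD2r.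
apply: (@le_trans _ _ ((nu K)%:E + inner_content (V `\` K))).
  apply: leeD2l; apply: ereal_inf_lbound; exists (V `\` K) => //.
  split; first by rewrite setDE; apply: openI => //; exact: closed_openC.
  by move=> x [Vx Ux]; split=> // /KVU[].
rewrite addeC -leeBrDr//; apply: ge_ereal_sup => _ [L [cL LVK] <-].
rewrite leeBrDr// -EFinD.
have [_ _ nuU] := pnu; rewrite -nuU//; last first.
  by apply/seteqP; split=> x //= [/LVK[]].
apply: inner_content_ge; first exact: closedU.
by move=> x [/LVK[]|/KVU[]].
Qed.

Let outer_content_borel (A : set (borel X)) : measurable A ->
  (@measurable _ (caratheodory_type outer_content)) A.
Proof.
apply: smallest_sub; last by move=> U oU; exact: outer_content_caratheodory.
split; [exact: measurable0|move=> B mB; rewrite setTD; exact: measurableC|].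
by move=> F mF; exact: bigcupT_measurable.
Qed.

(** The same function, retyped so that the measure lives on the Borel sigma-algebra rather than on
    the Caratheodory one. *)
Let content_measure : set (borel X) -> \bar R := outer_content.

Let content_measure_sigma_additive : semi_sigma_additive content_measure.
Proof.
move=> F mF tF mUF.
have := @caratheodory_measure_sigma_additive R X outer_content F.
by apply=> //; [move=> n|]; exact: outer_content_borel.
Qed.

(** Passing from [nu] to [mu], closed sets can only gain mass and open sets can only lose it. As in
    the portmanteau theorem, a set squeezed between an open and a closed set of equal [mu]-mass
    keeps its [nu]-mass. *)
Lemma content_to_measure : exists mu : probability (borel X) R,
  (forall K, closed K -> (nu K)%:E <= mu K) /\
  (forall U, open U -> mu U = inner_content U).
Proof.
have muT : content_measure setT = 1.
  rewrite /content_measure outer_content_open; last exact: openT.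
  apply/eqP; rewrite eq_le; apply/andP; split.
    by rewrite (le_trans (inner_content_le _))//; case: pnu => _ ->.
  have [_ <- _] := pnu; apply: inner_content_ge => //; exact: closedT.
pose M := @isMeasure.Build _ _ _ content_measure outer_content0
  outer_content_ge0 content_measure_sigma_additive.
pose m : {measure set (borel X) -> \bar R} := HB.pack content_measure M.
pose P := @Measure_isProbability.Build _ (borel X) R m muT.
pose mu : probability (borel X) R := HB.pack (Measure.sort m) P.
by exists mu; split; [exact: outer_content_closed|exact: outer_content_open].
Qed.

End ContentToMeasure.

(** * Borel probabilities on a compact metric space *)

Section BorelSets.
Context {R : realType} {X : pointedMetricType R}.
Implicit Types (T : X -> X) (A U K : set (borel X)).

Lemma open_borel U : open (U : set X) -> measurable U.
Proof. exact: sub_sigma_algebra. Qed.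

Lemma closed_borel K : closed (K : set X) -> measurable K.
Proof.
move=> cK; rewrite -[K]setCK; apply: measurableC; apply: open_borel.
exact: closed_openC.
Qed.

Lemma preimage_borel T A : continuous T -> measurable A ->
  measurable (T @^-1` A : set (borel X)).
Proof.
move=> /continuousP cT.
have : sigma_algebra [set: borel X] [set B : set (borel X) |
    measurable (T @^-1` B : set (borel X))].
  split => /=; first by rewrite preimage_set0; exact: measurable0.
  - by move=> B mB; rewrite setTD preimage_setC; exact: measurableC.
  - by move=> F mF; rewrite preimage_bigcup; exact: bigcupT_measurable.
move=> /smallest_sub h mA; apply: (h (@open X)) => // U oU.
by apply: open_borel; exact: cT.
Qed.

Lemma measurable_fun_borel (f : X -> R) : continuous f ->
  measurable_fun [set: borel X] (f : borel X -> R).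
Proof.
move=> /continuousP cf; apply: (measurability _ (measurable_realfun.RGenOpens.measurableE R)).
move=> _ [_ [a [b ->] <-]]; rewrite setTI; apply: open_borel.
exact/cf/interval_open.
Qed.

Lemma continuous_compact_bounded (hX : compact [set: X]) (f : X -> R) :
  continuous f -> exists2 M : R, 0 <= M & forall x, `|f x| <= M.
Proof.
move=> cf; have : compact (f @` [set: X]).
  by apply: continuous_compact => //; exact: continuous_subspaceT.
move=> /compact_bounded[M [_ MP]]; exists (`|M| + 1); first by rewrite addr_ge0.
by move=> x; apply: (MP (`|M| + 1)) => //; rewrite ltr_pwDr// ler_norm.
Qed.

End BorelSets.

Section BorelProbability.
Context {R : realType} {X : pointedMetricType R}.
Hypothesis hX : compact [set: X].
Implicit Types mu : probability (borel X) R.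

Lemma integrable_continuous mu (f : X -> R) : continuous f ->
  mu.-integrable setT (fun x => (f x)%:E).
Proof.
move=> cf; apply: measurable_bounded_integrable => //.
- by rewrite (le_lt_trans (probability_le1 _ _))// ltry.
- exact: measurable_fun_borel.
- have [M M0 fM] := continuous_compact_bounded hX cf.
  exists M; split; first exact: num_real.
  by move=> B MB x _ /=; rewrite (le_trans (fM x))// ltW.
Qed.

(** The sets may overlap: the lemma serves for cells together with exceptional times, and for nested
    level sets. *)
Lemma Rintegral_step mu (I : finType) (c : I -> R) (A : I -> set (borel X)) :
  (forall i, measurable (A i)) ->
  mu.-integrable setT (fun x => (\sum_i c i * \1_(A i) x)%:E) /\
  \int[mu]_x (\sum_i c i * \1_(A i) x) = \sum_i c i * fine (mu (A i)).
Proof.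
move=> mA; elim: (index_enum I) => [|i s [ih1 ih2]].
  under eq_fun do rewrite big_nil.
  under eq_Rintegral do rewrite big_nil.
  by rewrite big_nil Rintegral_cst// mul0r; split=> //; exact: integrable0.
have i1 : mu.-integrable setT (fun x => (\1_(A i) x)%:E).
  exact: integrable_indic.
have i2 : mu.-integrable setT (fun x => (c i * \1_(A i) x)%:E).
  by under eq_fun do rewrite EFinM; exact: integrableZl.
split.
  under eq_fun do rewrite big_cons EFinD.
  exact: integrableD.
under eq_Rintegral do rewrite big_cons.
rewrite RintegralD// ih2 big_cons RintegralZl//; congr (_ * _ + _).
by rewrite /Rintegral integral_indic// setIT.
Qed.

Lemma Rintegral_le_step mu (I : finType) (c : I -> R) (A : I -> set (borel X))
    (f : X -> R) : continuous f -> (forall i, measurable (A i)) ->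
  (forall x, f x <= \sum_i c i * \1_(A i) x) ->
  \int[mu]_x f x <= \sum_i c i * fine (mu (A i)).
Proof.
move=> cf mA fA; have [h <-] := Rintegral_step mu c mA.
by apply: le_Rintegral => //; exact: integrable_continuous.
Qed.

Lemma Rintegral_ge_step mu (I : finType) (c : I -> R) (A : I -> set (borel X))
    (f : X -> R) : continuous f -> (forall i, measurable (A i)) ->
  (forall x, \sum_i c i * \1_(A i) x <= f x) ->
  \sum_i c i * fine (mu (A i)) <= \int[mu]_x f x.
Proof.
move=> cf mA fA; have [h <-] := Rintegral_step mu c mA.
by apply: le_Rintegral => //; exact: integrable_continuous.
Qed.

Lemma le_Rintegral_continuous mu (f h : X -> R) : continuous f -> continuous h ->
  (forall x, f x <= h x) -> \int[mu]_x f x <= \int[mu]_x h x.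
Proof. by move=> cf ch fh; apply: le_Rintegral => //; exact: integrable_continuous. Qed.

Lemma RintegralD_continuous mu (f h : X -> R) : continuous f -> continuous h ->
  \int[mu]_x (f x + h x) = \int[mu]_x f x + \int[mu]_x h x.
Proof. by move=> cf ch; apply: RintegralD => //; exact: integrable_continuous. Qed.

Lemma Rintegral_cst_probability mu (c : R) : \int[mu]_x c = c.
Proof.
rewrite Rintegral_cst// -[RHS]mulr1; congr (c * _).
by rewrite -[RHS]/(fine 1%E); congr fine; exact: probability_setT.
Qed.

Lemma Rintegral_invariant (T : X -> X) mu (f : X -> R) : continuous T ->
  invariant_measures T mu -> continuous f ->
  \int[mu]_x f (T x) = \int[mu]_x f x.
Proof.
move=> cT inv cf.
have mT : measurable_fun [set: borel X] (T : borel X -> borel X).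
  by move=> _ B mB; rewrite setTI; exact: preimage_borel.
rewrite /Rintegral; congr fine.
have cfT : continuous (f \o T).
  by move=> x; apply: continuous_comp; [exact: cT|exact: cf].
rewrite -[LHS](@integral_pushforward _ _ _ _ R _ mT mu setT (fun x => (f x)%:E))//.
- by apply: eq_measure_integral => A mA _; exact: inv.
- by apply/measurable_realfun.measurable_EFinP; exact: measurable_fun_borel.
- by rewrite preimage_setT; exact: (@integrable_continuous mu (f \o T)).
Qed.

End BorelProbability.

(** * Regularity of Borel probabilities *)

Section Regularity.
Context {R : realType} {X : pointedMetricType R}.
Variable mu : probability (borel X) R.
Implicit Types A : set (borel X).
Local Open Scope ereal_scope.

(** Inner and outer approximation are required together so that the property passes to
    complements. *)
Definition regular A := forall e : R, (0 < e)%R ->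
  exists K U : set (borel X), [/\ closed (K : set X), open (U : set X),
    K `<=` A, A `<=` U & mu (U `\` K) < e%:E].

Lemma regular_setC A : regular A -> regular (~` A).
Proof.
move=> rA e e0; have [K [U [cK oU KA AU UK]]] := rA e e0.
exists (~` U), (~` K); split; [exact: open_closedC|exact: closed_openC| | |].
- exact: subsetC.
- exact: subsetC.
- by rewrite setDE setCK setIC -setDE.
Qed.

Let increasing_gap (F : (set (borel X))^nat) (e : R) :
  (forall n, measurable (F n)) -> nondecreasing_seq F -> (0 < e)%R ->
  exists N, mu (\bigcup_n F n `\` F N) < e%:E.
Proof.
move=> mF ndF e0; have mUF : measurable (\bigcup_n F n) by exact: bigcupT_measurable.
have cvgF := nondecreasing_cvg_mu (mu := mu) mF mUF ndF.
have : mu (\bigcup_n F n) - e%:E < mu (\bigcup_n F n).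
  by rewrite lteBlDr// lteDl ?lte_fin// fin_num_measure.
move=> /(cvge_gt_near cvgF)[N _ /(_ N (leqnn N))/= muN]; exists N.
have FN : F N `<=` \bigcup_n F n by move=> x Fx; exists N.
have E : mu (\bigcup_n F n) = mu (F N) + mu (\bigcup_n F n `\` F N).
  rewrite -measureU//; [by rewrite setDUK|exact: measurableD|by rewrite setDIK].
by move: muN; rewrite EFinN lteBlDr// E lteD2lE// fin_num_measure.
Qed.

(** [U] is the increasing union of the closed sets of points whose ball of radius [1/(n+1)] lies in
    [U]; continuity from below selects one of them. *)
Lemma regular_open U : open (U : set X) -> regular U.
Proof.
move=> oU e e0.
pose F n : set (borel X) := [set x : X | U x /\ ball x n.+1%:R^-1 `<=` (U : set X)]%R.
have cF n : closed (F n : set X).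
  rewrite (_ : F n = [set x : X | setT x /\ ball x n.+1%:R^-1 `<=` (U : set X)]%R).
    by apply: closed_ball_subset; exact: closedT.
  apply/seteqP; split=> x [? h]; split=> //; apply: h.
  by apply: ballxx; rewrite invr_gt0.
have mF n : measurable (F n) by exact: closed_borel.
have ndF : nondecreasing_seq F.
  move=> n m nm; apply/subsetPset => x [Ux xU]; split=> // y xy; apply: xU.
  apply: le_ball xy; by rewrite lef_pV2 ?posrE// ler_nat ltnS.
have FU : \bigcup_n F n = U.
  apply/seteqP; split=> [x [n _ []]//|x Ux].
  have /nbhs_ballP[r /= r0 rU] :=
    open_nbhs_nbhs (conj oU Ux : open_nbhs (x : X) (U : set X)).
  have [N _ /(_ N (leqnn N)) /= Nr] := near_infty_natSinv_lt (PosNum r0).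
  exists N => //; split=> // y xy; apply: rU; apply: le_ball xy.
  exact: ltW.
have [N gap] := increasing_gap mF ndF e0.
by exists (F N), U; split=> //; [move=> x []|rewrite -{1}FU].
Qed.

(** A countable union of closed sets need not be closed, so it is cut at a finite stage [N]. This
    costs [e / 2]; the errors of the individual sets add up to the other [e / 2]. *)
Lemma regular_bigcup (A : (set (borel X))^nat) :
  (forall n, regular (A n)) -> regular (\bigcup_n A n).
Proof.
move=> rA e e0; have e2 : (0 < e / 2)%R by rewrite divr_gt0.
have en n : (0 < e / 2 / (2 ^ n.+1)%:R)%R by rewrite divr_gt0// ltr0n expn_gt0.
have /choice[K KP] n := rA n _ (en n).
have /choice[U UP] := KP.
have cK n : closed (K n : set X) by case: (UP n).
have oU n : open (U n : set X) by case: (UP n).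
have mK n : measurable (K n) by exact: closed_borel.
have mU n : measurable (U n) by exact: open_borel.
pose F n : set (borel X) := \big[setU/set0]_(i < n) K i.
have mF n : measurable (F n) by exact: bigsetU_measurable.
have ndF : nondecreasing_seq F.
  move=> n m nm; apply/subsetPset => x; rewrite /F -!bigcup_mkord => -[i /= i_n Ki].
  by exists i => //=; exact: leq_trans nm.
have [N gap] := increasing_gap mF ndF e2.
have FK : \bigcup_n F n = \bigcup_n K n.
  apply/seteqP; split=> x [n _].
    by rewrite /F -bigcup_mkord => -[i _ Ki]; exists i.
  by move=> Kx; exists n.+1 => //; rewrite /F -bigcup_mkord; exists n => /=.
exists (F N), (\bigcup_n U n); split.
- by rewrite /F; apply: closed_bigsetU => *; exact: cK.
- by apply: bigcup_open => n _; exact: oU.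
- move=> x; rewrite /F -bigcup_mkord => -[n _ Kx]; exists n => //.
  by have [_ _ KA _ _] := UP n; exact: KA.
- by apply: subset_bigcup => n _; case: (UP n).
- have mUK : measurable (\bigcup_n (U n `\` K n)).
    by apply: bigcupT_measurable => n; exact: measurableD.
  have mG : measurable (\bigcup_n F n `\` F N).
    by apply: measurableD => //; exact: bigcupT_measurable.
  apply: (@le_lt_trans _ _ (mu (\bigcup_n (U n `\` K n)) +
      mu (\bigcup_n F n `\` F N))).
    apply: (@le_trans _ _ (mu (\bigcup_n (U n `\` K n) `|` (\bigcup_n F n `\` F N)))).
      apply: le_measure; rewrite ?inE//.
      + by apply: measurableD => //; exact: bigcupT_measurable.
      + exact: measurableU.
      + move=> x [[n _ Ux] FNx]; have [Kx|nKx] := pselect (K n x).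
          by right; split=> //; rewrite FK; exists n.
        by left; exists n.
    exact: measureU2.
  rewrite [e]splitr EFinD; apply: lee_ltD => //; first exact: fin_num_measure.
    apply: le_trans (epsilon_trick0 xpredT (ltW e2)).
    apply: (le_trans (measure_sigma_subadditive _ _ mUK (@subset_refl _ _))).
      by move=> n; exact: measurableD.
    apply: lee_nneseries => [n *|n _]; first exact: measure_ge0.
    by case: (UP n) => _ _ _ _ /ltW.
Qed.

Lemma regular_measure A : measurable A -> regular A.
Proof.
apply: smallest_sub; last exact: regular_open.
split.
- by apply: regular_open; exact: open0.
- by move=> B rB; rewrite setTD; exact: regular_setC.
- exact: regular_bigcup.
Qed.

End Regularity.

(** Inner regularity extends the inequality to all Borel sets, and complements reverse it. This
    turns a one-sided estimate on closed sets into invariance of the limit measure. *)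
Lemma eq_probability_closed (R : realType) (X : pointedMetricType R)
    (m1 m2 : probability (borel X) R) :
  (forall K : set X, closed K -> (m1 K <= m2 K)%E) ->
  forall A : set (borel X), measurable A -> m1 A = m2 A.
Proof.
move=> m12.
have le A : measurable A -> (m1 A <= m2 A)%E.
  move=> mA; apply/lee_addgt0Pr => e e0.
  have [K [U [cK oU KA AU UK]]] := regular_measure m1 mA e0.
  have mK : measurable K by exact: closed_borel.
  have mU : measurable U by exact: open_borel.
  have -> : m1 A = (m1 K + m1 (A `\` K))%E.
    rewrite -measureU//; [by rewrite setDUK|exact: measurableD|by rewrite setDIK].
  apply: leeD.
    by apply: (le_trans (m12 _ cK)); apply: le_measure; rewrite ?inE.
  apply: ltW; apply: le_lt_trans UK; apply: le_measure; rewrite ?inE.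
  - exact: measurableD.
  - exact: measurableD.
  - exact: setSD.
move=> A mA; apply/eqP; rewrite eq_le le//=.
have := le _ (measurableC mA); rewrite !probability_setC//.
by rewrite leeD2lE// leeN2.
Qed.

(** * Block entropies and potentials *)

Section BlockEntropy.
Context {R : realType} {X : pointedMetricType R}.
Variables (T : X -> X) (k : nat) (A : 'I_k -> set (borel X)).
Hypotheses (cT : continuous T) (pA : measurable_partition A).

Definition cell (a n : nat) (s : {ffun 'I_n -> 'I_k}) : set (borel X) :=
  iter a T @^-1` iterated_join T A s.

Definition block_entropy (Q : set (borel X) -> R) (a n : nat) : R :=
  shannon (fun s => Q (@cell a n s)).

Lemma continuous_iter n : continuous (iter n T).
Proof.
elim: n => [|n ih] x; first exact: cvg_id.
by apply: (@continuous_comp _ _ _ (iter n T) T); [exact: ih|exact: cT].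
Qed.

Lemma measurable_cell a n s : measurable (@cell a n s).
Proof.
apply: preimage_borel; first exact: continuous_iter.
have -> : iterated_join T A s =
    ~` \big[setU/set0]_(i < n) ~` (iter i T @^-1` A (s i)).
  apply/seteqP; split=> x.
    by rewrite -bigcup_seq => Ax [i _]; apply; exact: Ax.
  rewrite -bigcup_seq => h i; apply: contrapT => Ax; apply: h.
  by exists i => //; exact: mem_index_enum.
apply: measurableC; apply: bigsetU_measurable => i _; apply: measurableC.
by apply: preimage_borel; [exact: continuous_iter|case: pA].
Qed.

Lemma cell_disjoint a n (s s' : {ffun 'I_n -> 'I_k}) :
  s != s' -> cell a s `&` cell a s' = set0.
Proof.
have [_ dA _] := pA; apply: contra_neqP => /eqP/set0P[x [xs xs']].
apply/ffunP => i; apply/eqP/negPn/negP => /dA.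
by apply/eqP/set0P; exists (iter i T (iter a T x)); split; [exact: xs|exact: xs'].
Qed.

Lemma cell_cover a n : \bigcup_s @cell a n s = setT.
Proof.
have [_ _ AT] := pA; apply/seteqP; split=> // x _.
have /choice[c cP] y : exists i, A i y.
  by have : setT y by []; rewrite -AT => -[i _ ?]; exists i.
exists [ffun i : 'I_n => c (iter i T (iter a T x))] => //.
by move=> i; rewrite ffunE; exact: cP.
Qed.

Section Finprob.
Variable Q : set (borel X) -> R.
Hypothesis pQ : finprob measurable Q.

Local Notation algM := (set_algebra_measurable (borel X)).

Lemma sum_cell a n : \sum_s Q (@cell a n s) = 1.
Proof.
have [_ <- _] := pQ.
rewrite (finprob_total algM pQ measurableT (measurable_cell a (n:=n))).
- by apply: eq_bigr => s _; rewrite setTI.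
- exact: cell_disjoint.
- by rewrite cell_cover.
Qed.

(** Each fine cell lies in a single coarse cell and misses the others; [f] will read off a segment
    of an itinerary. *)
Lemma marginal_cell a b m n (f : {ffun 'I_n -> 'I_k} -> {ffun 'I_m -> 'I_k}) u :
  (forall s, cell a s `<=` cell b (f s)) ->
  Q (cell b u) = \sum_(s | f s == u) Q (cell a s).
Proof.
move=> sub.
rewrite (finprob_total algM pQ (measurable_cell b u) (measurable_cell a (n:=n)));
  [|exact: cell_disjoint|by rewrite cell_cover].
rewrite [RHS]big_mkcond/=; apply: eq_bigr => s _; case: ifPn => [/eqP <-|fsu].
  by congr Q; apply/setIidPr.
rewrite -(finprob0 algM pQ); congr Q; rewrite -subset0 -(cell_disjoint b fsu).
by rewrite setIC; apply: setSI.
Qed.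

(** An itinerary of length [m + n] is the pair of its first [m] and its last [n] letters, so
    [shannon_joint] applies. *)
Lemma block_entropy_cocycle : cocycle_subadditive (block_entropy Q).
Proof.
move=> a m n; have Q0 := fun s => finprob_ge0 pQ (@measurable_cell a (m + n) s).
apply: (shannon_joint
  (f := fun s : {ffun 'I_(m + n) -> 'I_k} => [ffun i => s (lshift n i)])
  (h := fun s : {ffun 'I_(m + n) -> 'I_k} => [ffun i => s (rshift m i)])) => //.
- exact: sum_cell.
- move=> u; apply: marginal_cell => s x xs i; rewrite ffunE.
  exact: (xs (lshift n i)).
- move=> u; apply: marginal_cell => s x xs i; rewrite ffunE.
  have := xs (rshift m i); rewrite /= -!iterD.
  by rewrite (_ : m + i + a = i + (a + m))%N//; lia.
- move=> s s' [/ffunP el /ffunP er]; apply/ffunP => i.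
  rewrite -[i]splitK; case: (fintype.split i) => j /=.
    by have := el j; rewrite !ffunE.
  by have := er j; rewrite !ffunE.
Qed.

Lemma block_entropy_ge0 a n : 0 <= block_entropy Q a n.
Proof.
apply: shannon_ge0 => s; have ms := measurable_cell a s.
by rewrite (finprob_ge0 pQ)// (finprob_le1 algM pQ).
Qed.

Lemma block_entropy_le a n : block_entropy Q a n <= n%:R * k%:R.
Proof.
elim: n => [|n ih]; last first.
  rewrite -addn1; apply: (le_trans (block_entropy_cocycle _ _ _)).
  rewrite natrD mulrDl lerD// mul1r.
  apply: le_trans (shannon_le_card _) _; last by rewrite card_ffun !card_ord expn1.
  by move=> s; exact: (finprob_ge0 pQ (measurable_cell _ _)).
rewrite mul0r /block_entropy /shannon oppr_le0 sumr_ge0// => s _.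
suff -> : Q (cell a s) = 1 by rewrite ln1 mulr0.
have [_ <- _] := pQ; congr Q; apply/seteqP; split=> // x _ [].
by [].
Qed.

End Finprob.

Lemma invariant_iter (mu : probability (borel X) R) a (B : set (borel X)) :
  invariant_measures T mu -> measurable B ->
  mu (iter a T @^-1` B) = mu B.
Proof.
move=> inv; elim: a B => [//|a ih] B mB.
by rewrite -(inv B mB) -(ih (T @^-1` B))//; exact: preimage_borel.
Qed.

Lemma block_entropy_invariant (mu : probability (borel X) R) a n :
  invariant_measures T mu ->
  block_entropy (fun B => fine (mu B)) a n =
    partition_entropy mu (@iterated_join _ _ T k A n).
Proof.
move=> inv; rewrite /block_entropy /shannon /partition_entropy.
congr (- _); apply: eq_bigr => s _.
have -> : mu (cell a s) = mu (iterated_join T A s); last by [].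
exact: (invariant_iter _ inv (measurable_cell 0 s)).
Qed.

(** Invariance removes the starting time, so Fekete's lemma applies; the bounds 0 and [k] make the
    limit a real number. *)
Lemma entropy_wrt_cvg (mu : probability (borel X) R) :
  invariant_measures T mu -> exists h : R,
  entropy_wrt T mu A = h%:E /\
  (n%:R^-1 * partition_entropy mu (@iterated_join _ _ T k A n) @[n --> \oo] --> h).
Proof.
move=> inv; pose H n := partition_entropy mu (@iterated_join _ _ T k A n).
have HE a n : H n = block_entropy (fun B => fine (mu B)) a n.
  by rewrite block_entropy_invariant.
have pmu := finprob_probability mu.
have Hle n : H n <= n%:R * k%:R by rewrite (HE 0%N); exact: block_entropy_le.
have H0 n : 0 <= H n by rewrite (HE 0%N); exact: block_entropy_ge0.
have /cvg_ex[l Hl] : cvgn (fun n => (n%:R^-1 * H n)%:E).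
  apply: (fekete (L := k%:R)) => // m n.
  by rewrite (HE 0%N (m + n)%N) (HE 0%N m) (HE m n); exact: block_entropy_cocycle.
have l0 : (0 <= l)%E.
  apply: (cvge_ge _ Hl); apply: nearW => n.
  by rewrite lee_fin mulr_ge0// invr_ge0.
have lk : (l <= k%:R%:E)%E.
  apply: (cvge_le _ Hl); near=> n; rewrite lee_fin ler_pdivrMl//.
  by rewrite ltr0n; near: n; exact: nbhs_infty_gt.
have lfin : l \is a fin_num.
  by rewrite ge0_fin_numE// (le_lt_trans lk)// ltry.
exists (fine l); rewrite fineK//; split; first exact: cvg_lim.
by move: Hl; rewrite -{1}(fineK lfin) => /fine_cvgP[].
Unshelve. all: by end_near. Qed.

End BlockEntropy.

(** * Asymptotically sub-additive potentials and their integrals *)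

Section Potentials.
Context {R : realType} {X : pointedMetricType R}.
Hypothesis hX : compact [set: X].
Variable T : X -> X.
Hypothesis cT : continuous T.

Lemma subadditive_potential_le (phi : nat -> X -> R) :
  subadditive_potential T phi -> exists2 M : R, 0 <= M &
  forall n x, (0 < n)%N -> phi n x <= n%:R * M.
Proof.
move=> [cphi sub]; have [M M0 phi1] := continuous_compact_bounded hX (cphi 1%N isT).
exists M => //; elim=> [//|[|n] ih] x _.
  by rewrite mul1r; exact: le_trans (ler_norm _) (phi1 _).
rewrite -addn1; apply: (le_trans (sub _ _ _ _ _)) => //.
rewrite natrD mulrDl lerD//; first exact: ih.
by rewrite mul1r; exact: le_trans (ler_norm _) (phi1 _).
Qed.

(** [cocycle_block] along the orbit of [x] replaces [phi_n] by a Birkhoff sum of the fixed function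
    [phi_q], with an error uniform in [x] and [n]. *)
Lemma subadditive_potential_block (phi : nat -> X -> R) :
  subadditive_potential T phi -> forall q, (0 < q)%N -> exists C : R,
  forall n x, (q <= n)%N ->
    q%:R * phi n x <= \sum_(t < n) phi q (iter t T x) + C.
Proof.
move=> [cphi sub] q q0.
have [M M0 phiM] := subadditive_potential_le (conj cphi sub).
have [B B0 phiq] := continuous_compact_bounded hX (cphi q q0).
exists (q%:R * B + 2 * q%:R ^+ 2 * M) => n x qn.
(* The length 0 is set to 0 because [phi 0] is unconstrained. *)
pose h a m := if m is 0%N then 0 else phi m (iter a T x).
have hsub : cocycle_subadditive h.
  move=> a [|m] [|n']; rewrite /h ?addn0 ?add0n ?addr0 ?add0r//=.
  by rewrite (addnC a) iterD; exact: sub.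
have hL a m : h a m <= m%:R * M.
  by case: m => [|m]; [rewrite mul0r|exact: phiM].
have qn2 : (0 < q <= n)%N by rewrite q0.
have := cocycle_block hsub M0 hL qn2.
have hE a m : (0 < m)%N -> h a m = phi m (iter a T x) by case: m.
rewrite hE ?(leq_trans q0)//=.
under eq_bigr do rewrite hE//.
(* Putting back the last [q] terms of the Birkhoff sum costs at most [q B]. *)
suff : \sum_(t < n - q) phi q (iter t T x) <= \sum_(t < n) phi q (iter t T x) + q%:R * B.
  lra.
rewrite -(big_mkord xpredT (fun t => phi q (iter t T x))).
rewrite -[in leRHS](big_mkord xpredT (fun t => phi q (iter t T x))).
rewrite (big_cat_nat (leq0n (n - q)) (leq_subr q n))/= -addrA lerDl.
suff : - (\sum_(n - q <= t < n) phi q (iter t T x)) <= q%:R * B by lra.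
rewrite -sumrN; apply: (@le_trans _ _ (\sum_(n - q <= t < n) B)).
  by apply: ler_sum => t _; rewrite (le_trans _ (phiq (iter t T x)))// -normrN ler_norm.
by rewrite big_const_nat iter_addr_0 subKn// mulr_natl.
Qed.

Lemma asymp_subadditive_approx (f : nat -> X -> R) : asymp_subadditive T f ->
  forall e : R, 0 < e -> exists2 phi, subadditive_potential T phi &
    \forall n \near \oo, forall x, `|f n x - phi n x| <= n%:R * e.
Proof.
move=> [cf asy] e e0.
have [k k0 ke] : exists2 k, (0 < k)%N & k%:R^-1 < e.
  have [N _ /(_ N (leqnn N)) /= Ne] := near_infty_natSinv_lt (PosNum e0).
  by exists N.+1.
have [phi [sphi lim]] := asy k k0; exists phi => //.
have := limn_esup_lt_near (le_lt_trans lim (_ : (_ < e%:E)%E)).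
rewrite lte_fin => /(_ ke) near_lt; near=> n => x.
have n0 : (0 < n)%N by near: n; exact: nbhs_infty_gt.
have n0R : 0 < n%:R :> R by rewrite ltr0n.
have : ((n%:R^-1 * sup_norm (f n \- phi n))%:E < e%:E)%E by near: n.
rewrite lte_fin ltr_pdivrMl// => /ltW; apply: le_trans.
have [M1 _ fM] := continuous_compact_bounded hX (cf n n0).
have [M2 _ pM] := continuous_compact_bounded hX (sphi.1 n n0).
apply: ub_le_sup; last by exists x.
exists (M1 + M2) => _ [y _ <-] /=; apply: (le_trans (ler_normB _ _)).
exact: lerD.
Unshelve. all: by end_near. Qed.

Variables (mu : probability (borel X) R) (inv : invariant_measures T mu).

Lemma subadditive_potential_cvg (phi : nat -> X -> R) :
  subadditive_potential T phi ->
  cvgn (fun n => (n%:R^-1 * \int[mu]_x phi n x)%:E).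
Proof.
move=> sphi; have [cphi sub] := sphi.
have [M M0 phiM] := subadditive_potential_le sphi.
pose a n := if n is 0%N then 0 else \int[mu]_x phi n x.
have asub m n : a (m + n)%N <= a m + a n.
  case: m n => [|m] [|n]; rewrite /a ?addn0 ?add0n ?addr0 ?add0r//.
  rewrite -[X in _ <= _ + X](Rintegral_invariant hX
    (@continuous_iter _ _ _ cT m.+1) _ (cphi n.+1 isT)).
    have cphi' : continuous (fun x => phi n.+1 (iter m.+1 T x)).
      move=> x; apply: continuous_comp; first exact: continuous_iter.
      exact: cphi.
    rewrite -RintegralD_continuous//; [|exact: cphi].
    apply: le_Rintegral_continuous => //; [exact: cphi| |].
      by move=> x; apply: continuousD; [exact: cphi|exact: cphi'].
    by move=> x; exact: sub.
  by move=> B mB; exact: (invariant_iter cT).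
have aM n : a n <= n%:R * M.
  case: n => [|n]; first by rewrite mul0r.
  rewrite -(Rintegral_cst_probability mu (n.+1%:R * M)).
  apply: le_Rintegral_continuous => //; [exact: cphi|by move=> ?; exact: cvg_cst|].
  by move=> x; exact: phiM.
have := fekete M0 asub aM; move=> /cvg_ex[l al]; apply/cvg_ex; exists l.
by move: al; rewrite -cvg_shiftS => al; rewrite -cvg_shiftS.
Qed.

Lemma asymptotic_integralE (f : nat -> X -> R) : continuous_seq f ->
  asymptotic_integral f mu = limn (fun n => (n%:R^-1 * \int[mu]_x f n x)%:E).
Proof.
move=> cf; apply: (congr1 (fun u : nat -> \bar R => limn u)).
(* At [n = 0] both sides vanish since [0^-1 = 0], whatever [f 0] is. *)
apply/funext => -[|n]; first by rewrite invr0 mul0e mul0r.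
rewrite EFinM /Rintegral fineK//; apply: integrable_fin_num => //.
by apply: integrable_continuous => //; exact: cf.
Qed.

Lemma asymptotic_integral_cvg (f : nat -> X -> R) : asymp_subadditive T f ->
  (n%:R^-1 * \int[mu]_x f n x)%:E @[n --> \oo] --> asymptotic_integral f mu.
Proof.
move=> asy; have [cf _] := asy; rewrite asymptotic_integralE//.
apply: (cvg_approx (u := fun n => n%:R^-1 * \int[mu]_x f n x)) => e e0.
have [phi sphi near_phi] := asymp_subadditive_approx asy e0.
exists (fun n => n%:R^-1 * \int[mu]_x phi n x); first exact: subadditive_potential_cvg.
near=> n; have n0 : (0 < n)%N by near: n; exact: nbhs_infty_gt.
have n0R : 0 < n%:R :> R by rewrite ltr0n.
have close : forall x, `|f n x - phi n x| <= n%:R * e by near: n.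
have cfn := cf n n0; have cphin := sphi.1 n n0.
have cst : continuous (fun _ : X => n%:R * e) by move=> ?; exact: cvg_cst.
have H1 : \int[mu]_x f n x <= \int[mu]_x phi n x + n%:R * e.
  rewrite -[in leRHS](Rintegral_cst_probability mu (n%:R * e)).
  rewrite -RintegralD_continuous//; apply: le_Rintegral_continuous => //.
    by move=> x; apply: cvgD; [exact: cphin|exact: cvg_cst].
  by move=> x; have := close x; rewrite ler_norml => /andP[]; lra.
have H2 : \int[mu]_x phi n x <= \int[mu]_x f n x + n%:R * e.
  rewrite -[in leRHS](Rintegral_cst_probability mu (n%:R * e)).
  rewrite -RintegralD_continuous//; apply: le_Rintegral_continuous => //.
    by move=> x; apply: cvgD; [exact: cfn|exact: cvg_cst].
  by move=> x; have := close x; rewrite ler_norml => /andP[]; lra.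
rewrite -mulrBr normrM gtr0_norm ?invr_gt0// ler_pdivrMl// ler_norml; lra.
Unshelve. all: by end_near. Qed.

Lemma asymptotic_integral_lty (f : nat -> X -> R) : asymp_subadditive T f ->
  (asymptotic_integral f mu < +oo)%E.
Proof.
move=> asy; have [cf _] := asy.
have [phi sphi near_phi] := asymp_subadditive_approx asy ltr01.
have [M M0 phiM] := subadditive_potential_le sphi.
apply: (@le_lt_trans _ _ (M + 1)%:E); last by rewrite ltry.
apply: (cvge_le _ (asymptotic_integral_cvg asy)); near=> n.
have n0 : (0 < n)%N by near: n; exact: nbhs_infty_gt.
rewrite lee_fin ler_pdivrMl ?ltr0n//.
rewrite -(Rintegral_cst_probability mu (n%:R * (M + 1))).
apply: le_Rintegral_continuous => //; [exact: cf|by move=> ?; exact: cvg_cst|].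
have close : forall x, `|f n x - phi n x| <= n%:R * 1 by near: n.
by move=> x; have := close x; rewrite ler_norml => /andP[_]; have := phiM n x n0; lra.
Unshelve. all: by end_near. Qed.

End Potentials.

(** * The lower bound *)

Section ClosePoints.
Context {R : realType} {X : pointedMetricType R}.

(** Around [x], a small ball misses the closed union [W] of the [B i] that do not contain [x]; what
    remains within reach contains [x], so by disjointness it is a single [B i]. Compactness makes
    the radius uniform. *)
Lemma near_disjoint_closed (hX : compact [set: X]) k (B : 'I_k -> set X) :
  (forall i, closed (B i)) -> (forall i j, i != j -> B i `&` B j = set0) ->
  \forall e \near (0 : R)^'+, forall z i j p q, B i p -> B j q ->
    mdist z p <= e -> mdist z q <= e -> i = j.
Proof.
move=> cB dB; pose P e z := forall i j p q, B i p -> B j q ->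
  mdist z p <= e -> mdist z q <= e -> i = j.
suff H z : [set: X] z -> \forall z' \near z & e \near (0 : R)^'+, P e z'.
  have h := iffLR (compact_near_coveringP _) hX _ _ P (at_right_proper_filter 0) H.
  near=> e => z; have PT : [set: X] `<=` P e by near: e.
  exact: PT.
move: z => x _.
pose W := \big[setU/set0]_(i < k | ~~ `[< B i x >]) B i.
have cW : closed W.
  by rewrite /W -big_filter; apply: closed_bigsetU => i _; exact: cB.
have WE i p : B i p -> ~ W p -> B i x.
  move=> Bp nW; apply: contrapT => nB; apply: nW; rewrite /W -bigcup_seq_cond.
  by exists i => //=; rewrite mem_index_enum/=; apply/asboolPn.
have nWx : (~` W) x.
  by rewrite /W -bigcup_seq_cond => -[i /= /andP[_ /asboolPn]].
have /nbhs_ballP[r /= r0 rW] := open_nbhs_nbhs (conj (closed_openC cW) nWx).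
have r2 : 0 < r / 2 by rewrite divr_gt0.
exists (ball x (r / 2), [set e | e < r / 2]).
  by split=> /=; [exact: nbhsx_ballx|exact: nbhs_right_lt].
move=> [z e] /= [xz er] i j p q Bp Bq zp zq.
have far y : mdist z y <= e -> ~ W y.
  move=> zy; apply: rW; rewrite [r]splitr; apply: ball_triangle xz _.
  by rewrite ballEmdist/=; exact: le_lt_trans er.
have Bix := WE _ _ Bp (far _ zp); have Bjx := WE _ _ Bq (far _ zq).
apply/eqP/negPn/negP => /dB; apply/eqP/set0P; exists x; split.
Unshelve. all: by end_near. Qed.

Lemma dist_on_le (T : X -> X) n (L : {set 'I_n}) x y e : dist_on T L x y <= e ->
  forall i, i \in L -> mdist (iter i T x) (iter i T y) <= e.
Proof.
by move=> Le i iL; apply: le_trans Le; rewrite /dist_on; exact: le_bigmax_cond.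
Qed.

Lemma dist_on_sym (T : X -> X) n (L : {set 'I_n}) x y :
  dist_on T L x y = dist_on T L y x.
Proof. by rewrite /dist_on; apply: eq_bigr => i _; exact: metric_sym. Qed.

Lemma dist_on_xx (T : X -> X) n (L : {set 'I_n}) x : dist_on T L x x = 0.
Proof.
by rewrite /dist_on big1_idem ?[LHS]maxxx// => i _; rewrite mdistxx.
Qed.

End ClosePoints.

Section Counting.
Context {R : realType} {X : pointedMetricType R}.
Variables (T : X -> X) (k n gn : nat) (A : 'I_k -> set (borel X)).
Variables (B : 'I_k -> set X) (eps W : R) (F : X -> R).
Hypothesis pA : measurable_partition A.
Hypotheses (BA : forall i, B i `<=` A i) (eps0 : 0 < eps) (W0 : 0 <= W).
Hypothesis sepB : forall z i j p q, B i p -> B j q ->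
    mdist z p <= eps -> mdist z q <= eps -> i = j.

Definition exceptional (x : X) : {set 'I_n} :=
  [set i : 'I_n | ~~ `[< exists j, B j (iter i T x) >]]%SET.

(* By separation of the [B j], at most one [j] contributes the leading 1. *)
Definition match_weight (x : X) (i : 'I_n) (j : 'I_k) : R :=
  (`[< exists2 p, B j p & mdist (iter i T x) p <= eps >])%:R + expR (- W).

(** The sum over itineraries factorises over times, and each factor is at most
    [1 + k e^(-W) <= e^(k e^(-W))]. *)
Lemma sum_match_weight x : \sum_(s : {ffun 'I_n -> 'I_k})
  \prod_i match_weight x i (s i) <= expR (n%:R * (k%:R * expR (- W))).
Proof.
rewrite -bigA_distr_bigA/= expRM_natl -[X in expR _ ^+ X]card_ord.
rewrite -prodr_const; apply: ler_prod => i _; apply/andP; split.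
  by apply: sumr_ge0 => j _; rewrite addr_ge0 ?expR_ge0.
rewrite big_split/= sumr_const card_ord -[_ *+ k]mulr_natl.
apply: (@le_trans _ _ (1 + k%:R * expR (- W))); last exact: expR_ge1Dx.
rewrite lerD2r -natr_sum -[leRHS]/(1%:R) ler_nat.
set P := fun j => `[< exists2 p, B j p & mdist (iter i T x) p <= eps >].
have [/existsP[j Pj]|/existsPn none] := boolP [exists j, P j]; last first.
  by rewrite big1// => j _; rewrite -/(P j) (negbTE (none j)).
rewrite (bigD1 j)//= big1 ?addn0 ?leq_b1// => j' j'j; apply/eqP; rewrite eqb0.
apply/negP => /asboolP[p' Bp' d']; have /asboolP[p Bp d] := Pj.
by move/eqP: j'j; apply; exact: sepB Bp' Bp d' d.
Qed.

(** At a time of [L] that is not exceptional for [y], [T^i y] lies in [B (s i)] within [eps] of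
    [T^i x], so the weight is at least 1. Every other time has weight at least [e^(-W)], and at most
    [gn] times are outside [L]. *)
Lemma match_weight_ge x y (L : {set 'I_n}) (s : {ffun 'I_n -> 'I_k}) :
  iterated_join T A s y -> (n - gn <= #|L|)%N -> dist_on T L y x <= eps ->
  expR (- W * #|exceptional y|%:R) <=
    expR (W * gn%:R) * \prod_i match_weight x i (s i).
Proof.
move=> Ay Lg yx.
have key i : expR (- W * (i \in exceptional y)%:R - W * (i \notin L)%:R) <=
    match_weight x i (s i).
  rewrite /match_weight; have [ie|ie] := boolP (i \in exceptional y) => /=.
    apply: (@le_trans _ _ (expR (- W))); last by rewrite lerDr ler0n.
    rewrite ler_expR mulr1; have : 0 <= W * (i \notin L)%:R by rewrite mulr_ge0// ler0n.
    lra.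
  have [iL|iL] := boolP (i \in L) => /=; last first.
    by rewrite mulr0 add0r mulr1 lerDr ler0n.
  rewrite !mulr0 subr0 expR0 asboolT; first by rewrite lerDl expR_ge0.
  move: ie; rewrite inE negbK => /asboolP[j Bj].
  have ji : j = s i.
    have [_ dA _] := pA; apply/eqP/negPn/negP => /dA; apply/eqP/set0P.
    by exists (iter i T y); split; [exact: BA|exact: Ay].
  exists (iter i T y); first by rewrite -ji.
  by rewrite metric_sym; exact: dist_on_le yx i iL.
apply: (@le_trans _ _ (expR (W * gn%:R) *
    \prod_i expR (- W * (i \in exceptional y)%:R - W * (i \notin L)%:R))); last first.
  rewrite ler_wpM2l ?expR_ge0//; apply: ler_prod => i _.
  by rewrite expR_ge0 key.
rewrite -expR_sum -expRD ler_expR big_split/= -mulr_sumr -natr_sum sumrN.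
rewrite -mulr_sumr -natr_sum.
have -> : (\sum_i (i \in exceptional y) = #|exceptional y|)%N.
  by rewrite -sum1_card [RHS]big_mkcond/=; apply: eq_bigr => i _; case: ifP.
have Lc : (\sum_i (i \notin L) <= gn)%N.
  have -> : (\sum_i (i \notin L) = #|~: L|)%N.
    rewrite -sum1_card [RHS]big_mkcond/=; apply: eq_bigr => i _.
    by rewrite inE; case: ifP.
  by have := cardsC L; rewrite card_ord; lia.
have : W * (\sum_i (i \notin L))%:R <= W * gn%:R by rewrite ler_wpM2l// ler_nat.
lra.
Qed.

(* Itineraries attached to the same greedily chosen point differ only at
   mistaken or exceptional times, hence the sum over them is controlled by
   [sum_match_weight]. *)
Lemma separated_family (P : {set {ffun 'I_n -> 'I_k}})
    (x : {ffun 'I_n -> 'I_k} -> X) :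
  (forall s, s \in P -> iterated_join T A s (x s)) ->
  exists E : {set {ffun 'I_n -> 'I_k}}, [/\ E \subset P,
    {in E &, forall s t, s != t -> forall L : {set 'I_n}, (n - gn <= #|L|)%N ->
       eps < dist_on T L (x s) (x t)} &
    \sum_(s in P) expR (F (x s) - W * #|exceptional (x s)|%:R) <=
    expR (W * gn%:R + n%:R * (k%:R * expR (- W))) * \sum_(t in E) expR (F (x t))].
Proof.
move=> Px.
pose close s t := [exists L : {set 'I_n},
  (n - gn <= #|L|)%N && (dist_on T L (x s) (x t) <= eps)].
have crefl : reflexive close.
  move=> s; apply/existsP; exists [set: 'I_n]%SET.
  by rewrite cardsT card_ord leq_subr dist_on_xx ltW.
have csym : symmetric close.
  by move=> s t; apply: eq_existsb => L; rewrite dist_on_sym.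
have [E [EP Eind Ecov]] := greedy_independent (F \o x) P crefl csym.
exists E; split=> //.
  move=> s t sE tE st L LI; rewrite ltNge; apply/negP => le_eps.
  by have /negP := Eind s t sE tE st; apply; apply/existsP; exists L; rewrite LI.
have /choice[t tP] : forall s, exists t, s \in P ->
    [/\ t \in E, close s t & F (x s) <= F (x t)].
  move=> s; have [sP|sP] := boolP (s \in P); last by exists s.
  by have [t tE [st Fst]] := Ecov s sP; exists t.
set c := expR (W * gn%:R + _).
apply: (@le_trans _ _ (\sum_(s in P) expR (F (x (t s))) *
    (expR (W * gn%:R) * \prod_i match_weight (x (t s)) i (s i)))).
  apply: ler_sum => s sP; have [tE /existsP[L /andP[LI Lst]] Fst] := tP s sP.
  rewrite expRD; apply: ler_pM; rewrite ?expR_ge0 ?ler_expR// -mulNr.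
  exact: match_weight_ge (Px s sP) LI Lst.
(* Group the itineraries by the greedy point they are attached to. The weights being nonnegative,
   each group sums to at most the total over all itineraries. *)
rewrite (partition_big t (mem E))/=; last by move=> s sP; case: (tP s sP).
rewrite mulr_sumr; apply: ler_sum => u uE.
rewrite (eq_bigr (fun s : {ffun 'I_n -> 'I_k} => expR (F (x u)) * expR (W * gn%:R) *
   \prod_i match_weight (x u) i (s i))); last first.
  by move=> s /andP[_ /eqP <-]; rewrite mulrA.
rewrite -mulr_sumr [leRHS]mulrC -mulrA ler_wpM2l ?expR_ge0// /c expRD.
rewrite ler_wpM2l ?expR_ge0//; apply: le_trans (sum_match_weight (x u)).
rewrite [leRHS](bigID (fun s => (s \in P) && (t s == u)))/= lerDl sumr_ge0// => s _.
by rewrite prodr_ge0// => i _; rewrite addr_ge0 ?expR_ge0.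
Qed.

End Counting.

Section LowerBound.
Context {R : realType} {X : pointedMetricType R}.
Hypothesis hX : compact [set: X].
Variable T : X -> X.
Hypothesis cT : continuous T.

Lemma esum_image_seq (I : eqType) (s : seq I) (x : I -> X) (F : X -> R) :
  uniq s -> {in s &, injective x} ->
  (\esum_(y in [set` map x s]) (expR (F y))%:E = (\sum_(t <- s) expR (F (x t)))%:E)%E.
Proof.
move=> us xinj; rewrite esum_fset; [|exact: finite_seq|]; last first.
  by move=> y _; rewrite lee_fin expR_ge0.
by rewrite -fsbig_seq ?map_inj_in_uniq// big_map sumEFin.
Qed.

(** In the error, [W n eta] pays for the exceptional times, [1] for points that are only nearly
    optimal in their cells, and the last two terms for the counting in [separated_family]. *)
Lemma itinerary_bound (mu : probability (borel X) R) k (A : 'I_k -> set (borel X))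
    (B : 'I_k -> set X) (eps W eta : R) (n gn : nat) (F : X -> R) :
  invariant_measures T mu -> measurable_partition A ->
  (forall i, closed (B i)) -> (forall i, B i `<=` A i) ->
  0 < eps -> 0 <= W ->
  (forall z i j p q, B i p -> B j q ->
    mdist z p <= eps -> mdist z q <= eps -> i = j) ->
  fine (mu (~` \bigcup_i B i)) <= eta -> continuous F ->
  exists E : set X,
    [/\ forall x y, E x -> E y -> x <> y -> forall L : {set 'I_n},
          (n - gn <= #|L|)%N -> eps < dist_on T L x y &
        ((partition_entropy mu (@iterated_join _ _ T k A n) + \int[mu]_x F x
           - (W * n%:R * eta + 1 + W * gn%:R + n%:R * (k%:R * expR (- W))))%:E <=
         lne (\esum_(x in E) (expR (F x))%:E))%E].
Proof.
move=> inv pA cB BA e0 W0 sepB mueta cF.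
pose C := @iterated_join _ _ T k A n.
have mC s : measurable (C s) by exact: (measurable_cell cT pA 0 s).
have dC (s t : {ffun 'I_n -> 'I_k}) : s != t -> C s `&` C t = set0.
  by move=> st; exact: (cell_disjoint T pA 0 st).
have pmu := finprob_probability mu.
pose p s := fine (mu (C s)).
have p0 s : 0 <= p s by rewrite fine_ge0.
have p1 : \sum_s p s = 1 by exact: (sum_cell cT pA pmu 0 n).
pose exc x : R := #|exceptional T n B x|%:R.
pose S s := sup [set F x - W * exc x | x in C s].
have [M M0 FM] := continuous_compact_bounded hX cF.
have exc0 x : 0 <= exc x by rewrite ler0n.
have Sub s : has_ubound [set F x - W * exc x | x in C s].
  exists M => _ [x _ <-]; have := FM x; rewrite ler_norml => /andP[_].
  by have := mulr_ge0 W0 (exc0 x); lra.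
(* A null cell may be empty, so points are chosen only in cells of positive measure. *)
have /choice[x xP] : forall s, exists x, 0 < p s ->
    C s x /\ S s - 1 <= F x - W * exc x.
  move=> s; have [ps|_] := ltP 0 (p s); last by exists point.
  have Cs0 : C s !=set0.
    by apply/set0P/eqP => Cs; move: ps; rewrite /p Cs measure0 ltxx.
  have [|_ [x Cx <-] xS] := @sup_adherent _ [set F x - W * exc x | x in C s] 1 ltr01.
    by split=> //; have [y Cy] := Cs0; exists (F y - W * exc y), y.
  by exists x; split=> //; exact: ltW.
pose P := [set s : {ffun 'I_n -> 'I_k} | 0 < p s]%SET.
have PC s : s \in P -> C s (x s) by rewrite inE => /xP[].
have [E [EP Esep Esum]] := separated_family gn F pA BA e0 W0 sepB PC.
have xinj : {in E &, injective x}.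
  move=> s t sE tE xst; apply/eqP/negPn/negP => /dC; apply/eqP/set0P.
  exists (x s); split; first by apply: PC; exact: (fintype.subsetP EP).
  by rewrite xst; apply: PC; exact: (fintype.subsetP EP).
exists [set` map x (enum E)]; split.
  move=> _ _ /mapP[s + ->] /mapP[t + ->]; rewrite !mem_enum => sE tE xst L LI.
  by apply: Esep => //; apply/eqP => st; apply: xst; rewrite st.
rewrite esum_image_seq ?enum_uniq//; last first.
  by move=> s t; rewrite !mem_enum; exact: xinj.
rewrite big_enum/=.
pose Z := \sum_(s in P) expR (S s).
(* Pointwise, [F] is at most [S] of the current cell plus [W] per exceptional time; by invariance
   each time is exceptional with probability [mu G]. The sum type indexes cells and times in one
   step function. *)
have intF : \int[mu]_x F x <= \sum_s p s * S s + W * n%:R * eta.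
  pose G : set (borel X) := ~` \bigcup_i B i.
  have mG : measurable G.
    apply: measurableC; apply: closed_borel.
    rewrite (_ : \bigcup_i B i = \bigcup_(i in [set` index_enum 'I_k]) B i).
      by rewrite bigcup_seq; apply: closed_bigsetU => i _; exact: cB.
    by apply/seteqP; split=> z [i _ Bz]; exists i => //; exact: mem_index_enum.
  pose c (i : {ffun 'I_n -> 'I_k} + 'I_n) := if i is inl s then S s else W.
  pose D (i : {ffun 'I_n -> 'I_k} + 'I_n) : set (borel X) :=
    match i with inl s => C s | inr i => iter i T @^-1` G end.
  have mD i : measurable (D i).
    case: i => [s|i] /=; first exact: mC.
    by apply: preimage_borel => //; exact: continuous_iter.
  have FD y : F y <= \sum_i c i * \1_(D i) y.
    have [s0 _ Cs0] : (\bigcup_s C s) y by rewrite [X in X y](cell_cover T pA 0 n).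
    rewrite big_sumType/= (bigD1 s0)//= [X in _ + X + _]big1 ?addr0; last first.
      move=> s ss0; rewrite indicE memNset ?mulr0// => Cs.
      by have := dC s s0 ss0; apply/eqP/set0P; exists y.
    rewrite indicE mem_set// mulr1.
    have -> : \sum_(i < n) W * \1_(iter i T @^-1` G) y = W * exc y.
      rewrite -mulr_sumr /exc -sum1_card natr_sum [in RHS]big_mkcond/=; congr (_ * _).
      apply: eq_bigr => i _; rewrite inE indicE; case: asboolP => [[j Bj]|nB] /=.
        by rewrite memNset// => /(_ _)[]; exists j.
      by rewrite mem_set// => -[j _ Bj]; apply: nB; exists j.
    by rewrite -lerBlDr; apply: ub_le_sup => //; exists y.
  apply: (le_trans (Rintegral_le_step hX mu cF mD FD)).
  rewrite big_sumType/=; apply: lerD.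
    by apply: ler_sum => s _; rewrite mulrC.
  rewrite (eq_bigr (fun=> W * fine (mu G))); last first.
    by move=> i _; rewrite (invariant_iter cT _ inv mG).
  rewrite sumr_const card_ord -[_ *+ n]mulr_natl.
  have : n%:R * W * fine (mu G) <= n%:R * W * eta by rewrite ler_wpM2l// mulr_ge0.
  lra.
have gibbs := gibbs_variational S p0 p1.
have [s1 ps1] := sum1_pos p0 p1.
set ZE := \sum_(t in E) _ in Esum *; set c := expR (W * gn%:R + _) in Esum.
have Z_le : \sum_(s | 0 < p s) expR (S s) <= expR 1 * (c * ZE).
  apply: (@le_trans _ _ (expR 1 * \sum_(s in P) expR (F (x s) - W * exc (x s)))).
    rewrite mulr_sumr (eq_bigl (fun s => s \in P)); last by move=> s; rewrite inE.
    apply: ler_sum => s; rewrite inE => /xP[_ h]; rewrite -expRD ler_expR; lra.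
  by rewrite ler_wpM2l ?expR_ge0.
have Z0 : 0 < \sum_(s | 0 < p s) expR (S s).
  rewrite (bigD1 s1)//= ltr_pwDl ?expR_gt0// sumr_ge0// => s _; exact: expR_ge0.
have ZE0 : 0 < ZE.
  have := lt_le_trans Z0 Z_le; by rewrite pmulr_rgt0 ?expR_gt0// pmulr_rgt0 ?expR_gt0.
rewrite [(ZE <= 0)%R]leNgt ZE0/= lee_fin.
have : ln (\sum_(s | 0 < p s) expR (S s)) <= ln (expR 1 * (c * ZE)).
  by rewrite ler_ln ?posrE// !mulr_gt0 ?expR_gt0.
rewrite !lnM ?posrE ?mulr_gt0 ?expR_gt0// !expRK.
have -> : partition_entropy mu (@iterated_join _ _ T k A n) = shannon p by [].
lra.
Qed.

Lemma pressure_at_ge (mu : probability (borel X) R) k (A : 'I_k -> set (borel X))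
    (eps0 : R) (g : nat -> R -> nat) (f : nat -> X -> R) (c h l : R) :
  mistake_function eps0 g -> asymp_subadditive T f ->
  invariant_measures T mu -> measurable_partition A ->
  entropy_wrt T mu A = h%:E -> asymptotic_integral f mu = l%:E -> c < h + l ->
  \forall eps \near (0 : R)^'+, (c%:E <= pressure_at eps0 g T f eps)%E.
Proof.
move=> [eps00 hg] hf inv pA hE lE chl.
(* Six errors: convergence of the entropy, convergence of the integral, and the four terms of
   [itinerary_bound]. *)
pose d := (h + l - c) / 6; have d0 : 0 < d by rewrite /d; lra.
(* With this [W], [k e^(-W) <= d] follows from [e^W >= 1 + W]. Only then is [eta] chosen, so that
   [W eta <= d]. *)
pose W : R := k%:R / d; have W0 : 0 <= W by rewrite divr_ge0 ?ler0n// ltW.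
have kW : k%:R * expR (- W) <= d.
  rewrite expRN ler_pdivrMr ?expR_gt0//.
  apply: (@le_trans _ _ (d * (1 + W))); last by rewrite ler_wpM2l ?expR_ge1Dx// ltW.
  by rewrite mulrDr mulr1 /W mulrCA divff ?gt_eqF// mulr1 lerDr ltW.
pose eta := d / (W + 1); have eta0 : 0 < eta by rewrite divr_gt0// ltr_wpDl.
have Weta : W * eta <= d.
  rewrite /eta mulrCA; apply: ler_piMr; first exact: ltW.
  by rewrite ler_pdivrMr ?ltr_wpDl// mul1r; lra.
have ek : 0 < eta / k.+1%:R by rewrite divr_gt0.
have mA i : measurable (A i) by case: pA.
have /choice[B BP] i : exists B : set X, [/\ closed B, B `<=` A i &
    fine (mu (A i `\` B)) <= eta / k.+1%:R].
  have [K [U [cK oU KA AU UK]]] := regular_measure mu (mA i) ek.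
  have mK : measurable K by exact: closed_borel.
  have mU : measurable U by exact: open_borel.
  exists K; split=> //; rewrite -lee_fin fineK ?fin_num_measure//; last first.
    exact: measurableD.
  apply: ltW; apply: le_lt_trans UK; apply: le_measure; rewrite ?inE.
  - exact: measurableD.
  - exact: measurableD.
  - exact: setSD.
have cB i : closed (B i) by case: (BP i).
have BA i : B i `<=` A i by case: (BP i).
have mB i : measurable (B i : set (borel X)) by exact: closed_borel.
have dB i j : i != j -> B i `&` B j = set0.
  have [_ dA _] := pA; move=> /dA; rewrite -!subset0 => dAij.
  by apply: subset_trans dAij; exact: setISS.
have mueta : fine (mu (~` \bigcup_i B i)) <= eta.
  have algM := set_algebra_measurable (borel X); have pmu := finprob_probability mu.
  have mAB i : measurable (A i `\` B i) by exact: measurableD.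
  have := finprob_bigU_le algM pmu (index_enum 'I_k) mAB.
  have sub : ~` (\bigcup_i B i) `<=` \big[setU/set0]_i (A i `\` B i).
    move=> x nB; have [_ _ AT] := pA; have : setT x by [].
    rewrite -AT -bigcup_seq => -[i _ Ai]; exists i; first exact: mem_index_enum.
    by split=> // Bi; apply: nB; exists i.
  have mG : measurable (~` \bigcup_i B i : set (borel X)).
    apply: measurableC.
    rewrite (_ : \bigcup_i B i = \bigcup_(i in [set` index_enum 'I_k]) B i).
      by rewrite bigcup_seq; apply: bigsetU_measurable => i _; exact: mB.
    by apply/seteqP; split=> z [i _ Bz]; exists i => //; exact: mem_index_enum.
  have mAB' : measurable (\big[setU/set0]_i (A i `\` B i)).
    by apply: bigsetU_measurable => i _; exact: mAB.
  have le1 := finprob_le algM pmu mG mAB' sub.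
  have le2 : \sum_i fine (mu (A i `\` B i)) <= eta.
    apply: (@le_trans _ _ (\sum_(i < k) eta / k.+1%:R)).
      by apply: ler_sum => i _; case: (BP i).
    rewrite sumr_const card_ord -[_ *+ k]mulr_natl mulrA ler_pdivrMr// mulrC.
    by apply: ler_wpM2l; [exact: ltW|rewrite ler_nat].
  by move=> le3; exact: le_trans le1 (le_trans le3 le2).
have [h' [h'E Hcvg]] := entropy_wrt_cvg cT pA inv.
have {h'E} hh : h' = h by move: h'E; rewrite hE => -[].
rewrite {h'}hh in Hcvg.
have Icvg := asymptotic_integral_cvg hX cT inv hf; rewrite lE in Icvg.
near=> eps.
have e0 : 0 < eps by near: eps; exact: nbhs_right_gt.
have ee0 : eps <= eps0 by near: eps; exact: nbhs_right_le.
have sepB : forall z i j p q, B i p -> B j q ->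
    mdist z p <= eps -> mdist z q <= eps -> i = j.
  by near: eps; exact: near_disjoint_closed.
have [|_ gcvg] := hg eps; first by rewrite e0.
(* [n] grows with [eps] fixed: [g(n,eps) / n] tends to 0 for each [eps], not uniformly. *)
apply: limn_esup_ge_near; near=> n.
have n0 : (0 < n)%N by near: n; exact: nbhs_infty_gt.
have n0R : 0 < n%:R :> R by rewrite ltr0n.
have [E [Esep Ebound]] := itinerary_bound n (mistake_ext eps0 g n eps)
  inv pA cB BA e0 W0 sepB mueta (hf.1 n n0).
have Psum : (lne (\esum_(x in E) (expR (f n x))%:E) <=
    lne (mistake_partition_sum eps0 g T f n eps))%E.
  have E0 : (0 <= \esum_(x in E) (expR (f n x))%:E)%E.
    by apply: esum_ge0 => x _; rewrite lee_fin expR_ge0.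
  have EP : (\esum_(x in E) (expR (f n x))%:E <=
      mistake_partition_sum eps0 g T f n eps)%E.
    by apply: ereal_sup_ubound; exists E.
  by rewrite lee_lne// in_itv/= leey andbT//; exact: le_trans EP.
apply: (@le_trans _ _
  ((n%:R^-1)%:E * lne (\esum_(x in E) (expR (f n x))%:E))%E); last first.
  by apply: lee_wpmul2l => //; rewrite lee_fin invr_ge0 ltW.
apply: le_trans; last first.
  by apply: lee_wpmul2l Ebound; rewrite lee_fin invr_ge0 ltW.
rewrite -EFinM lee_fin ler_pdivlMl//.
have H1 : h - d <= n%:R^-1 * partition_entropy mu (@iterated_join _ _ T k A n).
  by near: n; apply: (cvgr_ge _ Hcvg); lra.
have H2 : l - d <= n%:R^-1 * \int[mu]_x f n x.
  rewrite -lee_fin; apply: ltW; near: n.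
  by apply: (cvge_gt_near Icvg); rewrite lte_fin; lra.
have H3 : n%:R^-1 * 1 <= d by near: n; exact: near_inv_le.
have H4 : W * ((mistake_ext eps0 g n eps)%:R / n%:R) <= d.
  rewrite /mistake_ext ee0; near: n.
  have : W * ((g n eps)%:R / n%:R) @[n --> \oo] --> W * 0.
    by apply: cvgM => //; exact: cvg_cst.
  by rewrite mulr0 => /cvgr_le; apply.
rewrite ler_pdivlMl// in H1; rewrite ler_pdivlMl// in H2; rewrite ler_pdivrMl// in H3.
rewrite mulrA ler_pdivrMr// in H4.
have H5 : n%:R * (k%:R * expR (- W)) <= n%:R * d by rewrite ler_wpM2l// ltW.
have H6 : n%:R * (W * eta) <= n%:R * d by rewrite ler_wpM2l// ltW.
have -> : c = h + l - 6 * d by rewrite /d; lra.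
lra.
Unshelve. all: by end_near. Qed.

End LowerBound.

(** * Partitions with null boundary *)

Section NullBoundary.
Context {R : realType} {X : pointedMetricType R}.
Variable mu : probability (borel X) R.
Implicit Types A B : set (borel X).

(** Equivalent to a null topological boundary, but stable under Boolean operations and preimages
    without computing interiors and closures. *)
Definition null_boundary A := exists U K : set (borel X),
  [/\ open (U : set X), closed (K : set X), U `<=` A, A `<=` K & mu (K `\` U) = 0%E].

Lemma open_mdist_lt (x : X) (r : R) : open [set y | mdist x y < r].
Proof.
rewrite openE => y /= xy; apply/nbhs_ballP; exists (r - mdist x y).
  by rewrite /= subr_gt0.
by move=> z; rewrite ballEmdist/= => yz; have := metric_triangle x y z; lra.
Qed.

Lemma closed_mdist_le (x : X) (r : R) : closed [set y | mdist x y <= r].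
Proof.
rewrite (_ : [set y | _] = ~` [set y | r < mdist x y]); last first.
  by apply/seteqP; split=> y /=; [move=> h; rewrite ltNge h|move/negP; rewrite -leNgt].
apply: open_closedC; rewrite openE => y /= xy.
apply/nbhs_ballP; exists (mdist x y - r); first by rewrite /= subr_gt0.
move=> z; rewrite ballEmdist/= => yz; have := metric_triangle x z y.
by rewrite (metric_sym z y); lra.
Qed.

Lemma null_boundary_setC A : null_boundary A -> null_boundary (~` A).
Proof.
move=> [U [K [oU cK UA AK KU]]]; exists (~` K), (~` U).
split; [exact: closed_openC|exact: open_closedC|exact: subsetC|exact: subsetC|].
by rewrite setDE setCK setIC -setDE.
Qed.

Lemma null_boundary_setI A B :
  null_boundary A -> null_boundary B -> null_boundary (A `&` B).
Proof.
move=> [U [K [oU cK UA AK KU]]] [V [L [oV cL VB BL LV]]].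
exists (U `&` V), (K `&` L); split; [exact: openI|exact: closedI|
  exact: setISS|exact: setISS|].
have mKU : measurable (K `\` U).
  by apply: measurableD; [exact: closed_borel|exact: open_borel].
have mLV : measurable (L `\` V).
  by apply: measurableD; [exact: closed_borel|exact: open_borel].
apply: (@subset_measure0 _ _ _ mu _ ((K `\` U) `|` (L `\` V))) => //.
- apply: measurableD; apply: measurableI; do ?exact: closed_borel; exact: open_borel.
- exact: measurableU.
- move=> x [[Kx Lx] UVx]; have [Ux|nUx] := pselect (U x); last by left.
  by right; split=> // Vx; apply: UVx.
- apply/eqP; rewrite eq_le measure_ge0 andbT.
  have KU0 : (mu (K `\` U) <= 0)%E by rewrite KU.
  have LV0 : (mu (L `\` V) <= 0)%E by rewrite LV.
  apply: (le_trans (measureU2 _ mKU mLV)); rewrite -[leRHS]adde0; exact: leeD.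
Qed.

Lemma null_boundaryT : null_boundary setT.
Proof.
by exists setT, setT; split; [exact: openT|exact: closedT| | |rewrite setDv measure0].
Qed.

Lemma null_boundary_preimage (T : X -> X) A : continuous T ->
  invariant_measures T mu -> null_boundary A -> null_boundary (T @^-1` A).
Proof.
move=> cT inv [U [K [oU cK UA AK KU]]].
exists (T @^-1` U), (T @^-1` K); split.
- by move/continuousP : cT; exact.
- by move/continuous_closedP : cT; exact.
- exact: preimage_subset.
- exact: preimage_subset.
- rewrite -KU; apply: inv.
  by apply: measurableD; [exact: closed_borel|exact: open_borel].
Qed.

(* The spheres around [x] are disjoint, so only countably many of them have
   positive measure. *)
Lemma null_sphere (x : X) (e : R) : 0 < e -> exists2 r, 0 < r < e &
  mu [set y : borel X | mdist x y = r :> R] = 0%E.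
Proof.
move=> e0; apply: contrapT => noR.
pose S r := [set y : borel X | mdist (x : X) (y : X) = r :> R].
have mS r : measurable (S r).
  rewrite (_ : S r = [set y | mdist x y <= r] `\` [set y | mdist x y < r]).
    by apply: measurableD; [apply: closed_borel; exact: closed_mdist_le|
       apply: open_borel; exact: open_mdist_lt].
  apply/seteqP; split=> y /=; first by move=> ->; rewrite lexx ltxx.
  by move=> [yr /negP]; rewrite -leNgt => ry; apply/eqP; rewrite eq_le yr.
have Sd r r' : r != r' -> S r `&` S r' = set0.
  by move=> /eqP rr'; rewrite -subset0 => y [/= yr yr']; apply: rr'; rewrite -yr -yr'.
have pmu := finprob_probability mu.
pose J m := [set r : R | m.+1%:R^-1 <= fine (mu (S r))].
(* Among disjoint spheres, [m + 2] of mass at least [1/(m+1)] would exceed total mass 1. *)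
have finJ m : finite_set (J m).
  apply: contrapT => /(infinite_set_fset m.+2)[B BJ mB].
  have := finprob_bigU (set_algebra_measurable (borel X)) pmu (finmap.fset_uniq B) mS Sd.
  set sB := finmap.enum_fset B in mB *.
  have mU : measurable (\big[setU/set0]_(i <- sB) S i) by exact: bigsetU_measurable.
  have := finprob_le1 (set_algebra_measurable (borel X)) pmu mU.
  move=> /[swap] -> sum1.
  have : \sum_(r <- sB) m.+1%:R^-1 <= \sum_(r <- sB) fine (mu (S r)).
    by rewrite !big_seq; apply: ler_sum => r rB; exact: BJ.
  rewrite big_const_seq count_predT iter_addr_0 -[_ *+ size sB]mulr_natl.
  move=> /le_trans/(_ sum1).
  by rewrite ler_pdivrMr// mul1r ler_nat -ltnS => /(leq_trans mB); rewrite ltnn.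
have cJ : countable (\bigcup_m J m).
  by apply: bigcup_countable => // m _; exact: finite_set_countable.
(* If no radius worked, the interval would be countable, against its positive Lebesgue measure. *)
have eJ : `]0, e[%classic `<=` \bigcup_m J m.
  move=> r; rewrite /= in_itv/= => r0e.
  have Sr : 0 < fine (mu (S r)).
    rewrite lt_neqAle fine_ge0// andbT; apply/negP => /eqP Sr.
    apply: noR; exists r => //; rewrite -[LHS]fineK; last first.
      by apply: fin_num_measure; exact: mS.
    by rewrite -[fine _]Sr.
  have [N _ /(_ N (leqnn N)) /= Ne] := near_infty_natSinv_lt (PosNum Sr).
  by exists N => //; exact: ltW.
have := countable_lebesgue_measure0 (sub_countable (subset_card_le eJ) cJ).
rewrite lebesgue_measure_itv/= lte_fin e0 sube0 => -[e00].
by rewrite e00 ltxx in e0.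
Qed.

(** Take a finite cover by balls of radius below [e / 2] with null spheres, and remove from each
    ball the earlier ones. *)
Lemma null_boundary_partition (hX : compact [set: X]) (e : R) : 0 < e ->
  exists k (A : 'I_k -> set (borel X)), [/\ measurable_partition A,
    forall i, null_boundary (A i) &
    forall i x y, A i x -> A i y -> mdist (x : X) (y : X) <= e].
Proof.
move=> e0; have e2 : 0 < e / 2 by rewrite divr_gt0.
have /choice[r rP] x : exists r, 0 < r < e / 2 /\
    mu [set y : borel X | mdist (x : X) (y : X) = r :> R] = 0%E.
  by have [r r0 rS] := null_sphere x e2; exists r.
have := hX; rewrite compact_cover => /(_ X setT (fun x => [set y | mdist x y < r x])).
move=> /(_ _ _)[x _|x _|D _ DX].
  exact: open_mdist_lt.
  by exists x => //=; rewrite mdistxx; have [/andP[]] := rP x.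
pose b x : set (borel X) := [set y | mdist x y < r x].
have nb x : null_boundary (b x).
  exists (b x), [set y : borel X | mdist x y <= r x]; split=> //.
  - exact: open_mdist_lt.
  - exact: closed_mdist_le.
  - by move=> y; exact: ltW.
  - rewrite -(rP x).2; congr (mu _); apply/seteqP; split=> y /=.
      by move=> [yr /negP]; rewrite -leNgt => ry; apply/eqP; rewrite eq_le yr.
    by rewrite /b/= => ->; rewrite lexx ltxx.
pose s := finmap.enum_fset D.
pose c i := nth point s i.
pose A (i : 'I_(size s)) : set (borel X) :=
  b (c i) `&` \big[setI/setT]_(j < i) ~` b (c j).
have mb x : measurable (b x) by apply: open_borel; exact: open_mdist_lt.
have AE i y : A i y <-> b (c i) y /\ forall j, (j < i)%N -> ~ b (c j) y.
  rewrite /A -(bigcap_mkord i (fun j => ~` b (c j))).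
  by split=> [[bi h]|[bi h]]; split=> // j; exact: h.
exists (size s), A; split.
- split.
  + move=> i; apply: measurableI => //; apply: bigsetI_measurable => j _.
    exact: measurableC.
  + move=> i j ij; rewrite -subset0 => y [/AE[bi hi] /AE[bj hj]].
    case: (ltngtP i j) => [/hj//|/hi//|/val_inj eij].
    by rewrite eij eqxx in ij.
  + apply/seteqP; split=> // y _.
    have [x /= xD xy] := DX y I.
    have : exists n, (n < size s)%N && `[< b (c n) y >].
      exists (index x s); rewrite index_mem xD/=; apply/asboolP.
      by rewrite /c nth_index.
    move=> /ex_minnP[n /andP[ns /asboolP bn] nmin].
    exists (Ordinal ns) => //; apply/AE; split=> // j jn bj.
    have := nmin j; rewrite (ltn_trans jn ns)/= asboolT// => /(_ isT).
    by rewrite leqNgt => /negP; apply.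
- move=> i; apply: null_boundary_setI => //.
  elim: (i : nat) => [|n ih]; first by rewrite big_ord0; exact: null_boundaryT.
  rewrite big_ord_recr/=; apply: null_boundary_setI => //.
  exact: null_boundary_setC.
- move=> i x y /AE[xi _] /AE[yi _]; rewrite /b/= in xi yi.
  have := metric_triangle x (c i) y; rewrite (metric_sym x (c i)).
  by have [/andP[_]] := rP (c i); lra.
Qed.

Lemma null_boundary_cell (T : X -> X) k (A : 'I_k -> set (borel X)) a n
    (s : {ffun 'I_n -> 'I_k}) : continuous T -> invariant_measures T mu ->
  (forall i, null_boundary (A i)) -> null_boundary (cell T A a s).
Proof.
move=> cT inv nA.
have iter_nb m B : null_boundary B -> null_boundary (iter m T @^-1` B).
  move=> nB; elim: m => [//|m ih].
  rewrite (_ : iter m.+1 T @^-1` B = T @^-1` (iter m T @^-1` B)).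
    exact: null_boundary_preimage.
  by apply/seteqP; split=> x; rewrite /preimage/= -iterSr.
apply: (iter_nb).
have -> : iterated_join T A s = \big[setI/setT]_(i < n) (iter i T @^-1` A (s i)).
  apply/seteqP; split=> x.
    by move=> Ax; rewrite -bigcap_seq => i _; exact: Ax.
  by rewrite -bigcap_seq => Ax i; apply: Ax; exact: mem_index_enum.
apply: big_ind => [|B C|i _]; [exact: null_boundaryT|exact: null_boundary_setI|].
exact: iter_nb.
Qed.

End NullBoundary.

(** * Limits of contents along an ultrafilter *)

(** A tangent to [-x ln x] lies above it and is continuous in [x], so one tangent per coordinate
    gives the upper estimate. *)
Lemma shannon_upper_semicontinuous (R : realType) (N : Type) (U : set_system N)
    (FU : Filter U) (I : finType) (p : N -> I -> R) (m : I -> R) :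
  (forall i, \forall n \near U, 0 <= p n i) -> (forall i, 0 <= m i) ->
  (forall i, p n i @[n --> U] --> m i) ->
  forall d, 0 < d -> \forall n \near U, shannon (p n) <= shannon m + d.
Proof.
move=> p0 m0 pm d d0.
pose d' := d / #|I|.+1%:R; have d'0 : 0 < d' by rewrite divr_gt0.
have coord i : \forall n \near U, - (p n i * ln (p n i)) <= - (m i * ln (m i)) + d'.
  have [m' m'0 m'm] : exists2 m', 0 < m' &
      - (m i * ln m') + (m' - m i) < - (m i * ln (m i)) + d'.
    have := m0 i; rewrite le_eqVlt => /predU1P[<-|mi0].
      (* No tangent exists at 0; the one at [d' / 2] takes the value [d' / 2] there. *)
      by exists (d' / 2); [|rewrite !mul0r]; lra.
    by exists (m i) => //; lra.
  have cvg : - (p n i * ln m') + (m' - p n i) @[n --> U] -->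
      - (m i * ln m') + (m' - m i).
    apply: cvgD; first by apply: cvgN; apply: cvgM; [exact: pm|exact: cvg_cst].
    by apply: cvgB; [exact: cvg_cst|exact: pm].
  near=> n; have pn0 : 0 <= p n i by near: n.
  apply: (le_trans (xlnx_tangent pn0 m'0)); apply: ltW; near: n.
  exact: (cvgr_lt _ cvg).
have all_coord : \forall n \near U, forall i,
    - (p n i * ln (p n i)) <= - (m i * ln (m i)) + d'.
  by apply: filter_forall => i; exact: coord.
near=> n; rewrite /shannon -!sumrN.
have h : forall i, - (p n i * ln (p n i)) <= - (m i * ln (m i)) + d' by near: n.
apply: (@le_trans _ _ (\sum_i (- (m i * ln (m i)) + d'))).
  by apply: ler_sum => i _; exact: h.
rewrite big_split/= lerD2l sumr_const -[_ *+ _]mulr_natl /d' mulrA ler_pdivrMr// mulrC.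
by apply: ler_wpM2l; [exact: ltW|rewrite ler_nat].
Unshelve. all: by end_near. Qed.

Lemma sum_level_le (R : realType) (y : R) (N : nat) : 0 <= y ->
  \sum_(j < N) (j.+1%:R <= y)%R%:R <= y.
Proof.
(* The sum is the integer part of [y] truncated at [N]; the extra bound by [N] carries the
   induction. *)
move=> y0; suff : \sum_(j < N) (j.+1%:R <= y)%R%:R <= y /\
    \sum_(j < N) (j.+1%:R <= y)%R%:R <= N%:R :> R by case.
elim: N => [|N [ih1 ih2]]; first by rewrite big_ord0.
rewrite big_ord_recr/=; case: (leP N.+1%:R y) => h /=; rewrite -natr1.
  by rewrite -natr1 in h; split; lra.
by split; lra.
Qed.

Lemma sum_level_ge (R : realType) (y : R) (N : nat) : y <= N%:R ->
  y - 1 <= \sum_(j < N) (j.+1%:R <= y)%R%:R.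
Proof.
move=> yN; suff : forall z, z <= y - 1 -> z <= N%:R ->
    z <= \sum_(j < N) (j.+1%:R <= y)%R%:R :> R by apply; lra.
elim: N {yN} => [|N ih] z zy zN; first by rewrite big_ord0.
rewrite big_ord_recr/=; rewrite -natr1 in zN.
case: (leP N.+1%:R y) => h /=; rewrite -natr1 in h.
  by have := ih (z - 1); lra.
by rewrite addr0; apply: ih; lra.
Qed.

(** A layer-cake approximation with closed superlevel sets and positive coefficients: upper
    estimates of contents on closed sets then suffice to bound means of [F] from above. *)
Lemma continuous_level_step (R : realType) (X : pointedMetricType R)
    (hX : compact [set: X]) (F : X -> R) (d : R) : continuous F -> 0 < d ->
  exists (c0 : R) (N : nat) (K : 'I_N -> set X), (forall j, closed (K j)) /\
    forall x, c0 + \sum_j d * \1_(K j) x <= F x <= c0 + \sum_j d * \1_(K j) x + d.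
Proof.
move=> cF d0; have [M M0 FM] := continuous_compact_bounded hX cF.
pose N := (Num.truncn (2 * M / d)).+1.
have NM : 2 * M / d <= N%:R by apply/ltW; exact: truncnS_gt.
exists (- M), N, (fun j => [set x | - M + d * j.+1%:R <= F x]); split.
  move=> j; apply: (@closed_comp _ _ F [set y | - M + d * j.+1%:R <= y]).
    by move=> x _; exact: cF.
  exact: closed_ge.
move=> x; rewrite -mulr_sumr.
pose y := (F x + M) / d.
have -> : \sum_(j < N) \1_[set x | - M + d * j.+1%:R <= F x] x =
    \sum_(j < N) (j.+1%:R <= y)%R%:R :> R.
  apply: eq_bigr => j _; rewrite indicE; congr (_ : bool)%:R.
  rewrite /y ler_pdivlMr//; apply/idP/idP => [/set_mem/= h|h]; first lra.
  by apply/mem_set => /=; lra.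
have Fy : F x = d * y - M by rewrite /y mulrCA divff ?gt_eqF//; lra.
have := FM x; rewrite ler_norml => /andP[F1 F2].
have y0 : 0 <= y by apply: divr_ge0; [lra|exact: ltW].
have yN : y <= N%:R.
  by apply: le_trans NM; rewrite ler_pM2r ?invr_gt0//; lra.
have h1 : d * \sum_(j < N) (j.+1%:R <= y)%R%:R <= d * y.
  by rewrite ler_pM2l//; exact: sum_level_le.
have h2 : d * (y - 1) <= d * \sum_(j < N) (j.+1%:R <= y)%R%:R.
  by rewrite ler_pM2l//; exact: sum_level_ge.
lra.
Qed.

Section UltraLimit.
Context {R : realType} {N : Type} (U : set_system N) {FU : UltraFilter U}.

(** Compactness of the segment gives a cluster point, and an ultrafilter converges to its cluster
    points. *)
Lemma ultra_cvg_bounded (u : N -> R) (a b : R) :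
  (\forall n \near U, a <= u n <= b) -> cvg (u n @[n --> U]).
Proof.
move=> uab; have := @segment_compact R a b; move=> /(_ (u @ U)).
have PF : ProperFilter (u @ U) by exact: fmap_proper_filter.
move=> /(_ PF)[|l [_ cl]].
  by move: uab; apply: filterS => n; rewrite /= in_itv.
apply/cvg_ex; exists l => V Vl /=.
have [//|nV] := in_ultra_setVsetC (u @^-1` V) FU.
by have [v [nv Vv]] := cl (~` V) V nV Vl.
Qed.

End UltraLimit.

Section WeakLimit.
Context {R : realType} {X : pointedMetricType R}.
Hypothesis hX : compact [set: X].
Context {U : set_system nat} {FU : UltraFilter U}.
Variables (T : X -> X) (Q : nat -> set X -> R).
Hypothesis cT : continuous T.
Hypothesis pQ : \forall n \near U, finprob [set: set X] (Q n).
Hypothesis invQ : forall A, Q n (T @^-1` A) - Q n A @[n --> U] --> (0 : R).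

Definition ultra_content (A : set X) : R := lim (Q n A @[n --> U]).

Let algT := @set_algebraT X.

Lemma ultra_content_cvg A : Q n A @[n --> U] --> ultra_content A.
Proof.
apply: (@ultra_cvg_bounded _ _ _ _ _ 0 1); near=> n.
have pn : finprob [set: set X] (Q n) by near: n.
by rewrite (finprob_ge0 pn)// (finprob_le1 algT pn).
Unshelve. all: by end_near. Qed.

Lemma finprob_ultra_content : finprob [set: set X] ultra_content.
Proof.
split=> [A _||A B _ _ AB].
- apply: limr_ge; first by apply/cvg_ex; eexists; exact: ultra_content_cvg.
  near=> n; have [Q0 _ _] : finprob [set: set X] (Q n) by near: n.
  exact: Q0.
- apply: cvg_lim => //; apply: cvg_near_cst; near=> n.
  by have [_ ? _] : finprob [set: set X] (Q n) by near: n.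
- apply: cvg_lim => //; have QAB := cvgD (@ultra_content_cvg A) (@ultra_content_cvg B).
  apply: (cvg_trans _ (QAB _)); apply: (@near_eq_cvg _ _ _ _ (fun n => Q n A + Q n B)).
  near=> n.
  have [_ _ QU] : finprob [set: set X] (Q n) by near: n.
  by rewrite /= QU.
Unshelve. all: by end_near. Qed.

Lemma ultra_content_invariant A : ultra_content (T @^-1` A) = ultra_content A.
Proof.
apply/eqP; rewrite -subr_eq0; apply/eqP.
apply: (cvg_unique _ _ (@invQ A)) => //.
by apply: cvgB; exact: ultra_content_cvg.
Qed.

Lemma weak_limit : exists mu : probability (borel X) R,
  [/\ invariant_measures T mu,
      forall A : set (borel X), measurable A -> null_boundary mu A ->
        Q n A @[n --> U] --> fine (mu A) &
      forall K, closed K -> forall d, 0 < d ->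
        \forall n \near U, Q n K <= fine (mu K) + d].
Proof.
have pnu := finprob_ultra_content.
have [mu [muK muU]] := content_to_measure hX pnu.
have muK' K : closed K -> ultra_content K <= fine (mu K).
  by move=> cK; rewrite -lee_fin fineK ?muK// fin_num_measure//; exact: closed_borel.
have muU' V : open V -> fine (mu V) <= ultra_content V.
  move=> oV; rewrite -lee_fin fineK; last by rewrite fin_num_measure//; exact: open_borel.
  by rewrite muU//; exact: inner_content_le.
(* Preimages of closed subsets of the complement of [K] compete in the inner content of its
   preimage, whose mass is therefore not smaller; take complements. *)
have muT K : closed K -> (mu (T @^-1` K) <= mu K)%E.
  move=> cK; have oV := closed_openC cK.
  have mK : measurable (K : set (borel X)) by exact: closed_borel.
  have := @probability_setC _ _ _ mu (T @^-1` K) (preimage_borel cT mK).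
  have := @probability_setC _ _ _ mu K mK.
  rewrite preimage_setC (muU _ oV) (muU (T @^-1` (~` K))); last first.
    by move/continuousP: cT; exact.
  move=> E1 E2.
  have : (inner_content ultra_content (~` K) <=
          inner_content ultra_content (T @^-1` (~` K)))%E.
    apply: ge_ereal_sup => _ [L [cL LV] <-]; rewrite -ultra_content_invariant.
    apply: inner_content_ge; last exact: preimage_subset.
    by move/continuous_closedP : cT; exact.
  rewrite E1 E2 leeD2lE// leeN2; exact.
exists mu; split.
- have mT : measurable_fun [set: borel X] (T : borel X -> borel X).
    by move=> _ B mB; rewrite setTI; exact: preimage_borel.
  pose Tm : {mfun borel X >-> borel X} := HB.pack (T : borel X -> borel X)
    (isMeasurableFun.Build _ _ _ _ _ mT).
  exact: (@eq_probability_closed _ _ (distribution mu Tm) mu muT).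
- move=> A mA [V [K [oV cK VA AK KV]]].
  (* The sandwich is [mu V <= nu V <= nu A <= nu K <= mu K = mu V], where [nu] is the ultrafilter
     limit. *)
  suff <- : ultra_content A = fine (mu A) by exact: ultra_content_cvg.
  have mV : measurable V by exact: open_borel.
  have mK : measurable K by exact: closed_borel.
  have KE : mu K = mu V.
    rewrite -(setDUK (subset_trans VA AK)) measureU ?setDIK//; last exact: measurableD.
    by rewrite [X in (_ + X)%E]KV adde0.
  have pmu := finprob_probability mu; have algM := set_algebra_measurable (borel X).
  have m1 := finprob_le algM pmu mV mA VA.
  have m2 : fine (mu A) <= fine (mu V).
    by rewrite -KE; exact: (finprob_le algM pmu mA mK AK).
  have n1 := finprob_le algT pnu (A := V) (B := A) I I VA.
  have n2 := finprob_le algT pnu (A := A) (B := K) I I AK.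
  have := muU' V oV; have := muK' K cK; rewrite KE => h1 h2.
  by apply/eqP; rewrite eq_le; apply/andP; split; lra.
- move=> K cK d d0; near=> n.
  apply: (@le_trans _ _ (ultra_content K + d)).
    near: n; apply: (cvgr_le _ (@ultra_content_cvg K)); lra.
  by rewrite lerD2r muK'.
Unshelve. all: by end_near. Qed.

End WeakLimit.

(** * The upper bound *)

Section EmpiricalMeasures.
Context {R : realType} {X : pointedMetricType R}.
Variables (T : X -> X) (m : nat) (w : 'I_m -> R) (y : 'I_m -> X).

Definition atomic (A : set X) : R := \sum_i w i * \1_A (y i).

Definition empirical (n : nat) (A : set X) : R :=
  n%:R^-1 * \sum_(t < n) atomic (iter t T @^-1` A).

Definition empirical_mean (n : nat) (F : X -> R) : R :=
  n%:R^-1 * \sum_(t < n) \sum_i w i * F (iter t T (y i)).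

Hypotheses (w0 : forall i, 0 <= w i) (w1 : \sum_i w i = 1).

Let algT := @set_algebraT X.

Lemma finprob_atomic : finprob [set: set X] atomic.
Proof.
split=> [A _||A B _ _ AB].
- by apply: sumr_ge0 => i _; rewrite mulr_ge0// indicE ler0n.
- by rewrite -w1; apply: eq_bigr => i _; rewrite indicT mulr1.
- rewrite -big_split/=; apply: eq_bigr => i _; rewrite -mulrDr; congr (_ * _).
  rewrite !indicE in_setU; have [yA|yA] := boolP (y i \in A) => /=; last by rewrite add0r.
  rewrite memNset ?addr0// => yB.
  suff : (set0 : set X) (y i) by [].
  by rewrite -AB; split=> //; exact: set_mem yA.
Qed.

Lemma finprob_empirical n : (0 < n)%N -> finprob [set: set X] (empirical n).
Proof.
move=> n0; have [a0 a1 aU] := finprob_atomic; split=> [A _||A B _ _ AB].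
- by rewrite mulr_ge0 ?invr_ge0// sumr_ge0// => t _; exact: a0.
- rewrite /empirical (eq_bigr (fun=> 1)) => [|t _]; last by rewrite preimage_setT.
  by rewrite sumr_const card_ord mulVf// pnatr_eq0 -lt0n.
- rewrite -mulrDr -big_split/=; congr (_ * _); apply: eq_bigr => t _.
  by rewrite preimage_setU; apply: aU => //; rewrite -preimage_setI AB preimage_set0.
Qed.

(** The difference telescopes to two boundary terms in [[0, 1]]. *)
Lemma empirical_invariant n A : `|empirical n (T @^-1` A) - empirical n A| <= n%:R^-1.
Proof.
pose a t := atomic (iter t T @^-1` A).
have a01 t : 0 <= a t <= 1.
  by rewrite (finprob_ge0 finprob_atomic)// (finprob_le1 algT finprob_atomic).
have -> : empirical n (T @^-1` A) = n%:R^-1 * \sum_(t < n) a t.+1 by [].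
rewrite -mulrBr -sumrB normrM ger0_norm ?invr_ge0// ler_piMr ?invr_ge0//.
rewrite -(big_mkord xpredT (fun t => a t.+1 - a t)) telescope_sumr//.
by have := a01 n; have := a01 0%N; rewrite ler_norml; lra.
Qed.

Lemma empirical_mean_le_step n (F : X -> R) (c0 : R) N (K : 'I_N -> set X) (d : R) :
  (0 < n)%N ->
  (forall x, F x <= c0 + \sum_j d * \1_(K j) x + d) ->
  empirical_mean n F <= c0 + \sum_j d * empirical n (K j) + d.
Proof.
move=> n0 FK; have n0R : 0 < n%:R :> R by rewrite ltr0n.
rewrite /empirical_mean ler_pdivrMl//.
have -> : n%:R * (c0 + \sum_j d * empirical n (K j) + d) =
    \sum_(t < n) (c0 + d + \sum_j d * atomic (iter t T @^-1` K j)).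
  rewrite big_split/= sumr_const card_ord -[(c0 + d) *+ n]mulr_natl exchange_big/=.
  have -> : \sum_j d * empirical n (K j) =
      n%:R^-1 * \sum_j \sum_(t < n) d * atomic (iter t T @^-1` K j).
    rewrite mulr_sumr; apply: eq_bigr => j _.
    by rewrite /empirical mulrCA mulr_sumr.
  have : n%:R * n%:R^-1 = 1 :> R by rewrite divff// gt_eqF.
  set S := \sum_j _; move=> nn.
  have -> : n%:R * (c0 + n%:R^-1 * S + d) = n%:R * (c0 + d) + (n%:R * n%:R^-1) * S by lra.
  by rewrite nn mul1r.
apply: ler_sum => t _.
have -> : c0 + d + \sum_j d * atomic (iter t T @^-1` K j) =
    \sum_i w i * (c0 + \sum_j d * \1_(K j) (iter t T (y i)) + d).
  rewrite [RHS](eq_bigr (fun i => w i * (c0 + d) +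
      \sum_j d * (w i * \1_(iter t T @^-1` K j) (y i)))); last first.
    move=> i _; rewrite addrAC mulrDr; congr (_ + _); rewrite mulr_sumr.
    by apply: eq_bigr => j _; rewrite mulrCA.
  rewrite big_split/= -mulr_suml w1 mul1r; congr (_ + _).
  by rewrite exchange_big/=; apply: eq_bigr => j _; rewrite -mulr_sumr.
by apply: ler_sum => i _; rewrite ler_wpM2l.
Qed.

Section Partition.
Variables (k : nat) (A : 'I_k -> set (borel X)).
Hypotheses (cT : continuous T) (pA : measurable_partition A).

(** The [n]-block of the non-invariant atomic content is cut into [q]-blocks at all starting times;
    concavity then moves the average over these times inside the entropy. *)
Lemma block_entropy_empirical q n : (0 < q <= n)%N ->
  q%:R * block_entropy T A atomic 0 n <=
  n%:R * block_entropy T A (empirical n) 0 q + 2 * q%:R ^+ 2 * k%:R.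
Proof.
move=> /[dup] qn' /andP[q0 qn]; have n0 := leq_trans q0 qn.
have pa := finprobW (@measurable _ (borel X)) finprob_atomic.
have := cocycle_block (block_entropy_cocycle cT pA pa) (ler0n R k)
  (block_entropy_le cT pA pa) qn'.
move=> /le_trans; apply; rewrite lerD2r.
have cell0 t s : 0 <= atomic (cell T A t (n := q) s).
  exact: (finprob_ge0 pa (measurable_cell cT pA t s)).
have := shannon_concave cell0 n0; rewrite ler_pdivrMl ?ltr0n//; apply: le_trans.
rewrite -(big_mkord xpredT (fun t => block_entropy T A atomic t q)).
rewrite -[in leRHS](big_mkord xpredT (fun t => block_entropy T A atomic t q)).
rewrite (big_cat_nat (leq0n (n - q)) (leq_subr q n))/= lerDl sumr_ge0// => t _.
exact: block_entropy_ge0.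
Qed.

(** Separated points have distinct itineraries, since cells have diameter at most [e]. Hence the
    block entropy is at least that of the weights, and Gibbs weights give equality in the
    variational inequality. *)
Lemma entropy_separated (n : nat) (F : X -> R) (e : R) :
  (forall i, w i = expR (F (y i)) / \sum_j expR (F (y j))) ->
  (forall i a b, A i a -> A i b -> mdist (a : X) (b : X) <= e) -> 0 <= e ->
  (forall i j, i != j -> e < dist_on T [set: 'I_n]%SET (y i) (y j)) ->
  ln (\sum_j expR (F (y j))) <=
    block_entropy T A atomic 0 n + \sum_i w i * F (y i).
Proof.
move=> wE dA e0 sep; set Z := \sum_j _.
(* If [Z] were 0, all weights would be 0 by [0^-1 = 0] and could not sum to 1; this excludes
   [m = 0]. *)
have Z0 : 0 < Z.
  have Zge0 : 0 <= Z by apply: sumr_ge0 => j _; exact: expR_ge0.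
  rewrite lt_neqAle Zge0 andbT; apply/negP => /eqP Z0; have : \sum_i w i = 0.
    by apply: big1 => i _; rewrite wE -/Z -Z0 invr0 mulr0.
  by rewrite w1 => /eqP; rewrite oner_eq0.
have pa := finprobW (@measurable _ (borel X)) finprob_atomic.
have /choice[c cP] i : exists c, cell T A 0 (n := n) c (y i).
  have : setT (y i) by []; rewrite -(cell_cover T pA 0 n) => -[c _ ?].
  by exists c.
have cinj : injective c.
  move=> i j cij; apply/eqP/negPn/negP => /sep; apply/negP; rewrite -leNgt.
  rewrite /dist_on; apply: bigmax_le => // t _.
  by apply: (dA (c i t)); [exact: cP|rewrite cij; exact: cP].
have atom i : atomic (cell T A 0 (c i)) = w i.
  rewrite /atomic (bigD1 i)//= indicE mem_set ?mulr1; last exact: cP.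
  rewrite big1 ?addr0// => j ji; rewrite indicE memNset ?mulr0// => cj.
  have : c j != c i by apply: contra_neq ji => /cinj.
  by move=> /(cell_disjoint T pA 0); apply/eqP/set0P; exists (y j); split=> //; exact: cP.
have : \sum_i - (w i * ln (w i)) <= block_entropy T A atomic 0 n.
  rewrite /block_entropy /shannon -sumrN.
  have -> : \sum_i - (w i * ln (w i)) = \sum_(s in [set c i | i : 'I_m]%SET)
      - (atomic (cell T A 0 s) * ln (atomic (cell T A 0 s))).
    rewrite big_imset/=; last by move=> i j _ _; exact: cinj.
    by apply: eq_bigr => i _; rewrite atom.
  rewrite [leRHS](bigID (fun s => s \in [set c i | i : 'I_m]%SET))/= lerDl.
  apply: sumr_ge0 => s _; rewrite -mulrN.
  have ms := measurable_cell cT pA 0 s; rewrite mulr_ge0 ?(finprob_ge0 pa)//.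
  by rewrite oppr_ge0 ln_le0// (finprob_le1 (set_algebra_measurable (borel X)) pa).
have -> : \sum_i - (w i * ln (w i)) = ln Z - \sum_i w i * F (y i).
  rewrite -[ln Z]mul1r -w1 mulr_suml -sumrB; apply: eq_bigr => i _.
  by rewrite [in ln _]wE ln_div ?posrE ?expR_gt0// expRK; lra.
lra.
Qed.

End Partition.
End EmpiricalMeasures.

(** The full set of times is always admissible, so sets separated under mistakes are separated in
    the ordinary sense, and [g] disappears from the upper bound. *)
Lemma separated_points (R : realType) (X : pointedMetricType R) (T : X -> X)
    (eps0 : R) g (f : nat -> X -> R) (n : nat) (eps c : R) :
  (c%:E < lne (mistake_partition_sum eps0 g T f n eps))%E ->
  exists m (y : 'I_m -> X),
    (forall i j, i != j -> eps < dist_on T [set: 'I_n]%SET (y i) (y j)) /\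
    expR c < \sum_i expR (f n (y i)).
Proof.
move=> cP; have : ((expR c)%:E < mistake_partition_sum eps0 g T f n eps)%E.
  rewrite ltNge; apply/negP => Pc; move: cP; apply/negP; rewrite -leNgt.
  (* Monotonicity of [lne] is available on nonnegative values; the empty set is separated and has
     sum 0. *)
  have P0 : (0 <= mistake_partition_sum eps0 g T f n eps)%E.
    apply: ereal_sup_ubound; exists set0; last by rewrite esum_set0.
    by move=> x y [].
  rewrite -[leRHS](_ : lne (expR c)%:E = _); last by rewrite lne_EFin ?expR_gt0// expRK.
  by rewrite lee_lne// in_itv/= leey ?P0// lee_fin expR_ge0.
move=> /ereal_sup_gt[_ [E sepE <-] /ereal_sup_gt[_ [D [finD DE] <-]]].
rewrite fsbig_finite//= sumEFin lte_fin.
set s := finmap.enum_fset (fset_set D) => cs.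
have sD x : x \in s -> E x.
  by rewrite /s => xs; apply: DE; move: xs; rewrite in_fset_set// inE.
have us : uniq s by exact: finmap.fset_uniq.
exists (size s), (fun i => nth point s i); split.
  move=> i j ij; apply: sepE; [exact/sD/mem_nth|exact/sD/mem_nth| |].
    by move=> /eqP; rewrite nth_uniq// => /eqP /val_inj /eqP; rewrite (negbTE ij).
  by rewrite /mistake_sets/= cardsT card_ord leq_subr.
rewrite -(big_mkord xpredT (fun i => expR (f n (nth point s i)))).
by rewrite -(big_nth point xpredT (fun x => expR (f n x))).
Qed.

Section UpperBound.
Context {R : realType} {X : pointedMetricType R}.
Hypothesis hX : compact [set: X].
Variable T : X -> X.
Hypothesis cT : continuous T.

Lemma frequent_ultrafilter (P : nat -> Prop) :
  (forall N, exists2 n, (N <= n)%N & P n) ->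
  exists U : set_system nat, [/\ UltraFilter U, \forall n \near U, P n &
    forall D : set nat, (\forall n \near \oo, D n) -> U D].
Proof.
move=> freq.
have PW : ProperFilter (within P (\oo : set_system nat)).
  apply: Build_ProperFilter_ex => D [N _ ND]; have [n Nn Pn] := freq N.
  by exists n; exact: ND.
have [U [UU sub]] := ultraFilterLemma PW; exists U; split=> //.
- by apply: sub; exists 0%N.
- by move=> D [N _ ND]; apply: sub; exists N => // n Nn _; exact: ND.
Qed.

(** Everything that holds at a fixed [n] is collected here. The left side is free of [n], so only
    the right side has to be followed along the ultrafilter. *)
Lemma empirical_bound k (A : 'I_k -> set (borel X)) (f phi : nat -> X -> R)
    (eps e c C : R) (n q m : nat) (y : 'I_m -> X) :
  measurable_partition A -> 0 < eps ->
  (forall i a b, A i a -> A i b -> mdist (a : X) (b : X) <= eps) ->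
  (0 < q <= n)%N ->
  (forall x, `|f n x - phi n x| <= n%:R * e) ->
  (forall x, q%:R * phi n x <= \sum_(t < n) phi q (iter t T x) + C) ->
  (forall i j, i != j -> eps < dist_on T [set: 'I_n]%SET (y i) (y j)) ->
  expR (n%:R * c) < \sum_i expR (f n (y i)) ->
  let w i := expR (f n (y i)) / \sum_j expR (f n (y j)) in
  (forall i, 0 <= w i) -> \sum_i w i = 1 ->
  q%:R * c <= block_entropy T A (empirical T w y n) 0 q +
    empirical_mean T w y n (phi q) + q%:R * e +
    n%:R^-1 * (2 * q%:R ^+ 2 * k%:R + C).
Proof.
move=> pA eps_gt0 dA qn fphi phiC sep cZ w w0 w1.
have /andP[q0 q_n] := qn; have n0 := leq_trans q0 q_n.
have n0R : 0 < n%:R :> R by rewrite ltr0n.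
have q0R : 0 < q%:R :> R by rewrite ltr0n.
have {}cZ : n%:R * c < ln (\sum_i expR (f n (y i))).
  by rewrite -ltr_expR lnK// posrE (lt_trans _ cZ)// expR_gt0.
have lnZ := entropy_separated w0 w1 cT pA (fun i => erefl (w i)) dA (ltW eps_gt0) sep.
have blk := block_entropy_empirical y w0 w1 cT pA qn.
have wf : \sum_i w i * f n (y i) <= \sum_i w i * phi n (y i) + n%:R * e.
  have -> : n%:R * e = \sum_i w i * (n%:R * e) by rewrite -mulr_suml w1 mul1r.
  rewrite -big_split/=; apply: ler_sum => i _.
  rewrite -mulrDr ler_wpM2l//; have := fphi (y i).
  by rewrite ler_norml => /andP[_]; lra.
have wphi : q%:R * \sum_i w i * phi n (y i) <= n%:R * empirical_mean T w y n (phi q) + C.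
  rewrite /empirical_mean mulrA divff ?gt_eqF// mul1r exchange_big/=.
  have -> : C = \sum_i w i * C by rewrite -mulr_suml w1 mul1r.
  rewrite -big_split/= mulr_sumr.
  by apply: ler_sum => i _; rewrite -mulr_sumr -mulrDr mulrCA ler_wpM2l.
rewrite -(ler_pM2l n0R).
have nn : n%:R * n%:R^-1 = 1 :> R by rewrite divff// gt_eqF.
have h1 : q%:R * (n%:R * c) <= q%:R * block_entropy T A (atomic w y) 0 n +
    q%:R * \sum_i w i * f n (y i).
  rewrite -mulrDr ler_wpM2l ?ltW//; exact: lt_le_trans lnZ.
have h2 := ler_wpM2l (ltW q0R) wf.
set K := 2 * _ * _ + C.
have -> : forall a b d : R, n%:R * (a + b + d + n%:R^-1 * K) =
    n%:R * (a + b + d) + (n%:R * n%:R^-1) * K.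
  by move=> a b d; lra.
rewrite nn mul1r /K; lra.
Qed.

(** The measure comes first: the partition must have null boundaries for it, and the same measure
    must serve for all block lengths [q]. *)
Lemma pressure_at_le (eps0 : R) (g : nat -> R -> nat) (f : nat -> X -> R)
    (eps c : R) : asymp_subadditive T f -> 0 < eps ->
  (c%:E < pressure_at eps0 g T f eps)%E ->
  exists mu : probability (borel X) R, invariant_measures T mu /\
  exists k (A : 'I_k -> set (borel X)), measurable_partition A /\
  exists2 h : R, entropy_wrt T mu A = h%:E &
    ((c - h)%:E <= asymptotic_integral f mu)%E.
Proof.
move=> hf eps_gt0 /limn_esup_gt_freq freq; have [cf _] := hf.
pose sep n (d : {m & 'I_m -> X}) :=
  (forall i j, i != j -> eps < dist_on T [set: 'I_n]%SET (projT2 d i) (projT2 d j)) /\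
  expR (n%:R * c) < \sum_i expR (f n (projT2 d i)).
have [U [UU Ugood Uoo]] : exists U : set_system nat, [/\ UltraFilter U,
    \forall n \near U, (0 < n)%N /\ exists d, sep n d &
    forall D : set nat, (\forall n \near \oo, D n) -> U D].
  apply: frequent_ultrafilter => N.
  have [n Nn cn] := freq (maxn N 1); rewrite geq_max in Nn.
  have /andP[Nn' n0] := Nn; exists n => //; split=> //.
  have n0R : 0 < n%:R :> R by rewrite ltr0n.
  have : ((n%:R * c)%:E < lne (mistake_partition_sum eps0 g T f n eps))%E.
    by rewrite EFinM muleC -lte_pdivlMr// muleC.
  by move=> /separated_points[m [y ysep]]; exists (existT _ m y).
(* The number of points varies with [n], hence the dependent pair; where no good family exists the
   empty one is used. *)
have /choice[d dP] n : exists d, (0 < n)%N /\ (exists d, sep n d) -> sep n d.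
  have [[_ [d nd]]|?] := pselect ((0 < n)%N /\ exists d, sep n d); first by exists d.
  by exists (existT _ 0%N (fun=> point)).
pose y n := projT2 (d n).
pose w n i := expR (f n (y n i)) / \sum_j expR (f n (y n j)).
pose Q n := empirical T (w n) (y n) n.
have w0 n i : 0 <= w n i.
  by rewrite divr_ge0 ?expR_ge0// sumr_ge0// => j _; exact: expR_ge0.
have w1 n : sep n (d n) -> \sum_i w n i = 1.
  move=> [_ cZ]; rewrite -mulr_suml divff// gt_eqF//.
  by apply: lt_trans cZ; exact: expR_gt0.
have pQ : \forall n \near U, finprob [set: set X] (Q n).
  apply: filterS Ugood => n [n0 nd]; apply: finprob_empirical => //.
  exact/w1/dP.
have invQ A : Q n (T @^-1` A) - Q n A @[n --> U] --> (0 : R).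
  apply/cvgrPdist_le => e e0; near=> n.
  have [n0 nd] : (0 < n)%N /\ exists d, sep n d by near: n.
  rewrite sub0r normrN.
  apply: (le_trans (empirical_invariant T (y n) (w0 n) (w1 n (dP n (conj n0 nd))) n A)).
  rewrite -[leLHS]mulr1; near: n; apply: Uoo; exact: near_inv_le.
have [mu [inv muA muK]] := weak_limit hX cT pQ invQ.
exists mu; split=> //.
have [k [A [pA nA dA]]] := null_boundary_partition mu hX eps_gt0.
exists k, A; split=> //.
have [h [hE hcvg]] := entropy_wrt_cvg cT pA inv; exists h => //.
have fcvg := asymptotic_integral_cvg hX cT inv hf.
(* After division by [q], one [e] goes to the entropy at level [q], two to the comparisons of [phi]
   with [f], and at most five to the limit in [n]. *)
apply/lee_addgt0Pr => e8 e8_gt0; pose e := e8 / 8; have e0 : 0 < e by rewrite /e; lra.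
rewrite -leeBlDr//; apply: (cvge_ge _ fcvg).
have [phi sphi fphi] := asymp_subadditive_approx hX hf e0.
near=> q; rewrite lee_fin.
have q0 : (0 < q)%N by near: q; exact: nbhs_infty_gt.
have q0R : 0 < q%:R :> R by rewrite ltr0n.
have Hq : q%:R^-1 * partition_entropy mu (@iterated_join _ _ T k A q) <= h + e.
  by near: q; apply: (cvgr_le _ hcvg); lra.
have close : forall x, `|f q x - phi q x| <= q%:R * e by near: q.
have cphi := sphi.1 q q0; have cfq := cf q q0.
have Iphi : \int[mu]_x phi q x <= \int[mu]_x f q x + q%:R * e.
  rewrite -[in leRHS](Rintegral_cst_probability mu (q%:R * e)).
  rewrite -RintegralD_continuous//; last by move=> ?; exact: cvg_cst.
  apply: le_Rintegral_continuous => //.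
    by move=> x; apply: cvgD; [exact: cfq|exact: cvg_cst].
  by move=> x; have := close x; rewrite ler_norml => /andP[]; lra.
have key : q%:R * c <= partition_entropy mu (@iterated_join _ _ T k A q) +
    \int[mu]_x phi q x + q%:R * e + 5 * e.
  have [C phiC] := subadditive_potential_block hX sphi q0.
  have entU : \forall n \near U, block_entropy T A (Q n) 0 q <=
      partition_entropy mu (@iterated_join _ _ T k A q) + e.
    rewrite -(block_entropy_invariant cT pA 0 q inv).
    apply: shannon_upper_semicontinuous => //.
    + move=> s; apply: filterS pQ => n pn; exact: (finprob_ge0 pn).
    + by move=> s; rewrite fine_ge0.
    + move=> s; apply: muA; first exact: measurable_cell.
      exact: null_boundary_cell.
  have meanU : \forall n \near U, empirical_mean T (w n) (y n) n (phi q) <=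
      \int[mu]_x phi q x + 2 * e.
    (* One [e] is the height of a step; the other covers the [N] closed sets, each with an error
       [1/(N+1)] weighted by [e]. *)
    have [c0 [N [K [cK phiK]]]] := continuous_level_step hX cphi e0.
    have N0 : 0 < N.+1%:R^-1 :> R by rewrite invr_gt0.
    have QK : \forall n \near U, forall j, Q n (K j) <= fine (mu (K j)) + N.+1%:R^-1.
      by apply: filter_forall => j; exact: muK.
    have muphi : c0 + \sum_j e * fine (mu (K j)) <= \int[mu]_x phi q x.
      have cphi' : continuous (fun x => phi q x - c0).
        by move=> x; apply: cvgB; [exact: cphi|exact: cvg_cst].
      have phiK1 x : \sum_j e * \1_(K j) x <= phi q x - c0.
        by have /andP[+ _] := phiK x; lra.
      have mK j : measurable (K j : set (borel X)) by exact: closed_borel.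
      rewrite addrC -lerBrDr; apply: (le_trans (Rintegral_ge_step hX mu cphi' mK phiK1)).
      rewrite -[X in _ - X](Rintegral_cst_probability mu c0) RintegralB//.
      + exact: integrable_continuous.
      + by apply: integrable_continuous => // ?; exact: cvg_cst.
    near=> n; have [n0 nd] : (0 < n)%N /\ exists d, sep n d by near: n.
    have QKn : forall j, Q n (K j) <= fine (mu (K j)) + N.+1%:R^-1 by near: n.
    have phiK2 x : phi q x <= c0 + \sum_j e * \1_(K j) x + e by case/andP: (phiK x).
    have w1n := w1 n (dP n (conj n0 nd)).
    apply: (le_trans (empirical_mean_le_step T (y n) (w0 n) w1n n0 phiK2)).
    have : \sum_j e * Q n (K j) <= \sum_j e * fine (mu (K j)) + e.
      apply: (@le_trans _ _ (\sum_j (e * fine (mu (K j)) + e * N.+1%:R^-1))).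
        by apply: ler_sum => j _; rewrite -mulrDr ler_wpM2l// ltW.
      rewrite big_split/= lerD2l sumr_const card_ord -[_ *+ N]mulr_natl mulrCA.
      rewrite ger_pMr// ler_pdivrMr// mul1r ler_nat//.
    rewrite -/(Q n); lra.
  have errU : \forall n \near U, n%:R^-1 * (2 * q%:R ^+ 2 * k%:R + C) <= e.
    by apply: Uoo; exact: near_inv_le.
  have qU : \forall n \near U, (q <= n)%N by apply: Uoo; exact: nbhs_infty_ge.
  have closeU : \forall n \near U, forall x, `|f n x - phi n x| <= n%:R * e.
    exact: Uoo.
  (* The inequality does not involve [n], so a single [n] from the ultrafilter is enough. *)
  suff /filter_ex[//] : \forall n \near U, q%:R * c <=
    partition_entropy mu (@iterated_join _ _ T k A q) +
    \int[mu]_x phi q x + q%:R * e + 5 * e.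
  near=> n.
  have [n0 nd] : (0 < n)%N /\ exists d, sep n d by near: n.
  have sd := dP n (conj n0 nd); have [s1 s2] := sd.
  have q_n : (q <= n)%N by near: n.
  have close_n : forall x, `|f n x - phi n x| <= n%:R * e by near: n.
  have qn : (0 < q <= n)%N by rewrite q0.
  have := empirical_bound pA eps_gt0 dA qn close_n (fun x => phiC n x q_n)
    s1 s2 (w0 n) (w1 n sd).
  have : block_entropy T A (Q n) 0 q <=
      partition_entropy mu (@iterated_join _ _ T k A q) + e by near: n.
  have : empirical_mean T (w n) (y n) n (phi q) <= \int[mu]_x phi q x + 2 * e by near: n.
  have : n%:R^-1 * (2 * q%:R ^+ 2 * k%:R + C) <= e by near: n.
  rewrite -/(y n) -/(w n) -/(Q n); lra.
rewrite ler_pdivlMl//.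
rewrite ler_pdivrMl// in Hq.
have : 5 * e <= q%:R * (5 * e) by rewrite ler_peMl ?ler1n// mulr_ge0// ltW.
have -> : e8 = 8 * e by rewrite /e; lra.
lra.
Unshelve. all: by end_near. Qed.

End UpperBound.

(** * The variational principle for the pressure under mistakes *)

Theorem corollary1 (R : realType) (X : pointedMetricType R)
    (hX : compact [set: X]) (T : X -> X) (hT : continuous T)
    (eps0 : R) (g : nat -> R -> nat) (hg : mistake_function eps0 g)
    (f : nat -> X -> R) (hf : asymp_subadditive T f) :
  [/\ cvg (pressure_at eps0 g T f eps @[eps --> 0^'+]),
      (forall mu, invariant_measures T mu -> asymptotic_integral f mu = -oo%E) ->
        mistake_pressure eps0 g T f = -oo%E
    & ~ (forall mu, invariant_measures T mu -> asymptotic_integral f mu = -oo%E) ->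
        mistake_pressure eps0 g T f =
          ereal_sup [set (ks_entropy T mu + asymptotic_integral f mu)%E
                    | mu in [set mu | invariant_measures T mu
                                      /\ asymptotic_integral f mu <> -oo%E]]].
Proof.
set V := [set mu : probability (borel X) R | invariant_measures T mu
                                      /\ asymptotic_integral f mu <> -oo%E].
set S := ereal_sup _.
have lim : pressure_at eps0 g T f eps @[eps --> (0 : R)^'+] --> S.
  apply: cvge_squeeze_real => c.
    move=> /ereal_sup_gt[_ [mu [inv nNy] <-]] cmu.
    have lty := asymptotic_integral_lty hX hT inv hf.
    have [l lE] : exists l : R, asymptotic_integral f mu = l%:E.
      case: (asymptotic_integral f mu) nNy lty => [l _ _|//|//].
      by exists l.
    move: cmu; rewrite lE -lteBlDr//.
    move=> /ereal_sup_gt[_ [k [A [pA ->]]]].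
    have [h [hE _]] := entropy_wrt_cvg hT pA inv.
    rewrite hE -EFinB lte_fin => clh.
    by apply: (pressure_at_ge hX hT hg hf inv pA hE lE); lra.
  move=> Sc; near=> eps.
  have e0 : 0 < eps by near: eps; exact: nbhs_right_gt.
  (* A pressure above [c] would produce an invariant measure with entropy plus limit integral at
     least [c], against [S < c]. *)
  rewrite leNgt; apply/negP => /(pressure_at_le hX hT hf e0).
  move=> [mu [inv [k [A [pA [h hE ch]]]]]].
  suff : (c%:E <= S)%E by rewrite leNgt Sc.
  have nNy : asymptotic_integral f mu <> -oo%E by move=> E; rewrite E in ch.
  apply: (@le_trans _ _ (ks_entropy T mu + asymptotic_integral f mu)%E).
    rewrite -[c](subrKC h) EFinD; apply: leeD => //.
    by rewrite -hE; apply: ereal_sup_ubound; exists k, A.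
  by apply: ereal_sup_ubound; exists mu.
have PE : mistake_pressure eps0 g T f = S by exact: cvg_lim.
split=> [|allNy|_]; [by apply/cvg_ex; exists S| |exact: PE].
(* Here the supremum runs over the empty set. *)
rewrite PE; apply/eqP; rewrite -leeNy_eq.
by apply: ge_ereal_sup => _ [mu [inv nNy] <-]; case: nNy; exact: allNy.
Unshelve. all: by end_near. Qed.
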